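(* Let $I$ be an SF instance. Then $I$ admits a stable matching if and only if no GSP of $I$ contains a cycle (cyclic permutation) of odd length greater than 1.
   Context: A Stable Fixtures (SF) instance is $I=(A,\succ,c)$ where $A=\{a_1,\dots,a_n\}$ is a finite set of $n$ agents; each agent $a_i$ has a strict linear order $\succ_i$ over $A\setminus\{a_i\}$ (complete preference list), with the convention that every agent ranks itself last ($a_j\succ_i a_i$ for all $j\neq i$); $a\succeq_i b$ means $a\succ_i b$ or $a=b$. Each agent has an integer capacity $c_i$ with $1\le c_i<n$. A matching is a set $M$ of unordered pairs of distinct agents such that each $a_i$ lies in at most $c_i$ pairs; $M(a_i)$ is the set of partners of $a_i$ and worst$_i(M(a_i))$ its $\succ_i$-worst partner. A blocking pair of $M$ is a pair of distinct agents $a_i,a_j$ with $\{a_i,a_j\}\notin M$, ($|M(a_j)|<c_j$ or $a_i\succ_j$ worst$_j(M(a_j))$), and ($|M(a_i)|<c_i$ or $a_j\succ_i$ worst$_i(M(a_i))$). $M$ is stable if it has no blocking pair. A cyclic permutation of a nonempty set $A_r\subseteq A$ is a permutation $\Pi_r$ of $A_r$ consisting of a single cycle of length $|A_r|$ (length 1: a fixed point $(a_i)$; length 2: a transposition $(a_i\ a_j)$). Two cyclic permutations are distinct if some element is mapped to different elements by them. A GSP (generalised stable partition) of $I$ is a finite collection $\Pi=\{\Pi_1,\dots,\Pi_k\}$ of cyclic permutations $\Pi_r$ of sets $A_r\subseteq A$, pairwise distinct except that fixed points may be repeated, such that: (F1) for every $r$ and every $a_j\in A_r$, $\Pi_r(a_j)\succeq_j\Pi_r^{-1}(a_j)$;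 (F2) there are no distinct $a_i,a_j\in A$ with the transposition $(a_i\ a_j)\notin\Pi$ such that $a_j\succ_i\Pi_r^{-1}(a_i)$ and $a_i\succ_j\Pi_s^{-1}(a_j)$ for some $\Pi_r,\Pi_s\in\Pi$ with $a_i\in A_r$, $a_j\in A_s$; (F3) for every $a_i\in A$, the number of indices $r$ with $a_i\in A_r$ equals $c_i$; (F4) for all distinct $a_i,a_j\in A$, $|\{s:\Pi_s(a_i)=a_j\}|+|\{s:\Pi_s(a_j)=a_i\}|\le 2$. *)

(* Defs.v *)
From HB Require Import structures.
From mathcomp Require Import all_boot all_fingroup.

Set Implicit Arguments.
Unset Strict Implicit.
Unset Printing Implicit Defensive.

(* [pref i a b] reads "i strictly prefers a to b". The strict linear order of i
   over the other agents is extended to all of [A] by ranking i itself last. *)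
Record sf_instance (A : finType) := SFInstance {
  pref : A -> rel A;
  cap : A -> nat;
  pref_irr : forall i, irreflexive (pref i);
  pref_trans : forall i, transitive (pref i);
  pref_total : forall i a b, a != b -> pref i a b || pref i b a;
  pref_self_last : forall i j, j != i -> pref i j i;
  cap_bounds : forall i, 0 < cap i < #|A|
}.

Definition prefeq (A : finType) (I : sf_instance A) (i a b : A) : bool :=
  pref I i a b || (a == b).

Definition partners (A : finType) (M : {set {set A}}) (i : A) : {set A} :=
  [set j | [set i; j] \in M].

Definition is_matching (A : finType) (I : sf_instance A) (M : {set {set A}}) : Prop :=
  (forall e, e \in M -> #|e| = 2) /\
  (forall i, #|[set e in M | i \in e]| <= cap I i).

(* The default value i is used only when [S] is empty; an agent without partners
   is below its capacity, so blocking pairs do not depend on it. *)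
Definition worst (A : finType) (I : sf_instance A) (i : A) (S : {set A}) : A :=
  odflt i [pick w in S | [forall x in S, prefeq I i x w]].

Definition accepts (A : finType) (I : sf_instance A) (M : {set {set A}}) (i j : A) : bool :=
  (#|partners M i| < cap I i) || pref I i j (worst I i (partners M i)).

Definition blocking_pair (A : finType) (I : sf_instance A) (M : {set {set A}}) (i j : A) : bool :=
  [&& i != j, [set i; j] \notin M, accepts I M j i & accepts I M i j].

Definition stable_matching (A : finType) (I : sf_instance A) (M : {set {set A}}) : Prop :=
  is_matching I M /\ (forall i j, ~~ blocking_pair I M i j).

(* A permutation of the nonempty set [S] is encoded as a permutation of [A] that
   is the identity outside [S]. *)
Definition is_cyclic_perm (A : finType) (u : {set A} * {perm A}) : bool :=
  [&& u.1 != set0, perm_on u.1 u.2 & [forall x in u.1, porbit u.2 x == u.1]].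

(* The set is kept along with the permutation because every fixed point (a_i)
   has the identity as its underlying permutation of [A]. Two cycles of length
   greater than 1 are equal as pairs iff they map every element alike, since
   the permutation then determines the set as its support. *)
Definition cyclic_perm (A : finType) := {u : {set A} * {perm A} | is_cyclic_perm u}.

Definition cset (A : finType) (p : cyclic_perm A) : {set A} := (val p).1.

Definition cperm (A : finType) (p : cyclic_perm A) : {perm A} := (val p).2.

Definition transposition (A : finType) (i j : A) : {set A} * {perm A} :=
  ([set i; j], tperm i j).

(* The sequence stands for a finite collection with multiplicities; its order is
   irrelevant. In [gsp_F4], [cperm p i = j] with i != j forces i to be in
   [cset p], so membership need not be required separately. *)
Record is_gsp (A : finType) (I : sf_instance A) (Pi : seq (cyclic_perm A)) : Prop := IsGSP {
  gsp_distinct : uniq [seq p <- Pi | 1 < #|cset p|];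
  gsp_F1 : forall p j, p \in Pi -> j \in cset p ->
    prefeq I j (cperm p j) ((cperm p)^-1%g j);
  gsp_F2 : ~ exists i j : A,
    [/\ i != j, transposition i j \notin [seq val p | p <- Pi]
      & exists p q : cyclic_perm A,
        [/\ p \in Pi /\ q \in Pi, i \in cset p /\ j \in cset q,
            pref I i j ((cperm p)^-1%g i) & pref I j i ((cperm q)^-1%g j)]];
  gsp_F3 : forall i, count (fun p => i \in cset p) Pi = cap I i;
  gsp_F4 : forall i j, i != j ->
    count (fun p => cperm p i == j) Pi + count (fun p => cperm p j == i) Pi <= 2
}.

(* Main.v *)
Require Import Defs.
From HB Require Import structures.
From mathcomp Require Import all_boot all_fingroup zify.

(* Both directions work in the bipartite double cover, where every agent occurs
   once as a proposer and once as a receiver; the arcs i -> Pi(i) of a GSP, and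
   both orientations of a stable matching, are stable there.

   If a stable matching M and a GSP coexist, counting the pairs on which they
   differ shows that each such pair is refused at exactly one of its two ends and
   that each vertex is either better or worse off in M. Along a cycle of length
   at least 3, the agents that prefer all of their M-partners to their
   predecessor then alternate with the others, so the length is even.

   Conversely, let F be the antitone map sending a set L of pairs to the pairs
   (i, j) such that fewer than c_i agents k with (k, i) in L are better than j for
   i. Take L maximal with L <= F L and L <= F (F L), and put U = F L, so that
   L = F U. If L = U, the pairs that are in L in both directions form a stable
   matching. Otherwise, the arcs i -> j with (i, j) in L and (j, i) in U split
   into transpositions and into disjoint odd cycles: enlarging L along a cycle of
   rotation moves would contradict maximality unless that cycle is its own mirror
   image. *)

Set Implicit Arguments.
Unset Strict Implicit.
Unset Printing Implicit Defensive.

Lemma sum_leq_eq (T : finType) (P : pred T) (F G : T -> nat) :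
    (forall i, P i -> F i <= G i) -> \sum_(i | P i) G i <= \sum_(i | P i) F i ->
  forall i, P i -> F i = G i.
Proof.
move=> FG GF i Pi; apply/eqP.
have [le eq_sum] := leqif_sum (fun i Pi => leqif_eq (FG i Pi)).
have : \sum_(i | P i) F i == \sum_(i | P i) G i by rewrite eqn_leq le GF.
by rewrite eq_sum => /forall_inP; apply.
Qed.

(** * Ranks *)

Section Ranks.

Variables (A : finType) (I : sf_instance A).
Implicit Types (i j k : A) (S T : {set A}).

Definition rank i j := #|[set k | pref I i k j]|.

Lemma pref_rank i j k : pref I i j k = (rank i j < rank i k).
Proof.
have mono a b : pref I i a b -> rank i a < rank i b.
  move=> ab; apply/proper_card/properP; split.
    by apply/subsetP=> x; rewrite !inE => /(@pref_trans _ I i a x b); apply.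
  by exists a; rewrite !inE ?ab // pref_irr.
apply/idP/idP => [/mono //|lt_jk].
have njk : j != k by apply: contraTneq lt_jk => ->; rewrite ltnn.
have /orP[//|/mono] := pref_total I i njk.
by move=> /ltn_trans/(_ lt_jk); rewrite ltnn.
Qed.

Lemma rank_inj i : injective (rank i).
Proof.
move=> a b eq_ab; apply/eqP/contraT => /(pref_total I i).
by rewrite !pref_rank eq_ab ltnn.
Qed.

Lemma prefeq_rank i j k : prefeq I i j k = (rank i j <= rank i k).
Proof. by rewrite /prefeq pref_rank (leq_eqVlt (rank i j)) (inj_eq (@rank_inj i)) orbC. Qed.

Definition above i S j := #|[set k in S | rank i k < rank i j]|.

Definition top c i S := [set j in S | above i S j < c].

Lemma above_le i S j : above i S j <= #|S|.
Proof. by apply/subset_leq_card/subsetP => k; rewrite inE => /andP[]. Qed.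

Lemma above_mono i S j k : rank i j <= rank i k -> above i S j <= above i S k.
Proof.
move=> jk; apply/subset_leq_card/subsetP => x.
by rewrite !inE => /andP[-> /leq_trans]; apply.
Qed.

Lemma aboveS i S T j : S \subset T -> above i S j <= above i T j.
Proof.
move=> /subsetP ST; apply/subset_leq_card/subsetP => x.
by rewrite !inE => /andP[/ST -> ->].
Qed.

Lemma topS c i S : top c i S \subset S.
Proof. by apply/subsetP => x; rewrite inE => /andP[]. Qed.

(** Induction on the size of [S], removing its worst element [w]: the counts of the others do not
    change, and [w] has all [n] others above it, so it is in the top exactly if [n < c]. *)
Lemma card_top c i S : #|top c i S| = minn c #|S|.
Proof.
elim: {S}#|S| {-2}S (erefl #|S|) => [|n IHn] S cardS.
  by have := subset_leq_card (topS c i S); rewrite cardS minn0 leqn0 => /eqP.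
have [s0 s0S] : exists s, s \in S by apply/card_gt0P; rewrite cardS.
have [w wS wmax] : exists2 w, w \in S & forall x, x \in S -> rank i x <= rank i w.
  by case: (@arg_maxnP _ s0 (mem S) (rank i) s0S) => w; exists w.
have cardSw : #|S :\ w| = n by apply/eqP; rewrite -eqSS -cardS (cardsD1 w S) wS.
have aboveSw j : j \in S :\ w -> above i S j = above i (S :\ w) j.
  rewrite !inE => /andP[njw jS]; apply: eq_card => x; rewrite !inE.
  by have [->|//] := eqVneq x w; rewrite ltnNge wmax // andbF.
have above_w : above i S w = n.
  rewrite -cardSw; apply: eq_card => x; rewrite !inE andbC.
  have [xS|] := boolP (x \in S); last by rewrite !andbF.
  by rewrite !andbT ltn_neqAle (inj_eq (@rank_inj i)) wmax ?andbT.
have /IHn := cardSw; rewrite cardSw => IH.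
have -> : top c i S = if n < c then w |: top c i (S :\ w) else top c i (S :\ w).
  apply/setP => x; have [->|nxw] := eqVneq x w.
    by rewrite !inE wS above_w; case: ifP => nc; rewrite !inE eqxx.
  have [xS|nxS] := boolP (x \in S :\ w).
    by case: ifP => _; rewrite !inE -?aboveSw // (negPf nxw).
  have := nxS; rewrite !inE nxw /= => nxS'.
  by case: ifP => _; rewrite !inE (negPf nxw) (negPf nxS') ?andbF.
have ntop : w \notin top c i (S :\ w) by rewrite !inE eqxx.
case: ltnP => nc; rewrite ?cardsU1 ?ntop IH cardS; lia.
Qed.

Lemma above_ltT c i S j : #|S| < c -> above i S j < c.
Proof. exact: leq_ltn_trans (above_le _ _ _). Qed.

Lemma top_above c i S w j : w \in top c i S -> rank i j <= rank i w -> above i S j < c.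
Proof. by rewrite inE => /andP[_ wc] /(above_mono S) /leq_ltn_trans; apply. Qed.

(** If all members of the full top were strictly better than [j], these [c] agents would be counted
    above [j]. *)
Lemma above_top c i S j : above i S j < c -> #|top c i S| = c ->
  exists2 w, w \in top c i S & rank i j <= rank i w.
Proof.
move=> jc cardT; apply/exists_inP; apply: contraLR jc => /exists_inPn tj.
rewrite -leqNgt -{1}cardT; apply/subset_leq_card/subsetP => x xT.
by rewrite inE (subsetP (topS c i S)) //= ltnNge tj.
Qed.

End Ranks.

Section Partners.

Variables (A : finType) (M : {set {set A}}).
Hypothesis M2 : forall e, e \in M -> #|e| = 2.

Lemma self_not_partner i : i \notin partners M i.
Proof. by rewrite inE; apply/negP => /M2; rewrite setUid cards1. Qed.

Lemma card_partners i : #|[set e in M | i \in e]| = #|partners M i|.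
Proof.
have inj : {in partners M i &, injective (fun j => [set i; j])}.
  move=> j k ij ik /setP/(_ j); rewrite !inE eqxx orbT => /esym/orP[] /eqP // eq_ji.
  by have := self_not_partner i; rewrite -{1}eq_ji ij.
rewrite -(card_in_imset inj); apply: eq_card => e; rewrite !inE.
apply/andP/imsetP => [[eM ie]|[j + ->]]; last by rewrite !inE eqxx.
have /eqP/cards2P[x [y [_ def_e]]] := M2 eM.
move: ie; rewrite def_e !inE => /orP[] /eqP ->.
  by exists y; rewrite // inE -def_e.
by exists x; rewrite 1?setUC // inE setUC -def_e.
Qed.

End Partners.

(** * Orbits and cyclic permutations *)

Section Cycles.

Variable A : finType.
Implicit Types (s : {perm A}) (i j x : A).

(** The remainder [r] also satisfies [iter r s x = x]; as the iterates of [x] below the orbit size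
    are distinct, [r] is 0. *)
Lemma porbit_dvdn s x n : iter n s x = x -> #|porbit s x| %| n.
Proof.
have m0 : 0 < #|porbit s x| by rewrite lt0n card_porbit_neq0.
rewrite {1}(divn_eq n #|porbit s x|) addnC iterD.
have -> k : iter (k * #|porbit s x|) s x = x.
  by elim: k => // k IHk; rewrite mulSn iterD IHk iter_porbit.
set r := n %% _ => itr; have rm : r < #|porbit s x| by rewrite ltn_pmod.
rewrite /dvdn -/r -(@nth_uniq _ x (traject s x #|porbit s x|)) ?size_traject //.
  by rewrite !nth_traject // itr.
exact: uniq_traject_porbit.
Qed.

Lemma mem_porbit_perm s x y : (s y \in porbit s x) = (y \in porbit s x).
Proof. by rewrite -!eq_porbit_mem -[s y]/((s ^+ 1)%g y) porbit_perm. Qed.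

Lemma restr_porbitE s x y : y \in porbit s x -> restr_perm (porbit s x) s y = s y.
Proof.
move=> yx; apply: restr_permE => //; apply/astabsP => z.
exact: mem_porbit_perm.
Qed.

Lemma porbit_cyclic s x : is_cyclic_perm (porbit s x, restr_perm (porbit s x) s).
Proof.
apply/and3P; split=> /=.
- by apply/set0Pn; exists x; apply: porbit_id.
- exact: restr_perm_on.
apply/forall_inP => y yx.
have powE n : (restr_perm (porbit s x) s ^+ n)%g y = (s ^+ n)%g y.
  elim: n => [|n IHn]; rewrite ?expg0 ?perm1 // !expgSr !permM IHn restr_porbitE //.
  by have := yx; rewrite -eq_porbit_mem => /eqP <-; apply: mem_porbit.
have /eqP orb_y : porbit s y == porbit s x by rewrite eq_porbit_mem.
rewrite -[X in _ == X]orb_y; apply/eqP/setP => z.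
by apply/porbitP/porbitP => -[n ->]; exists n; rewrite powE.
Qed.

Lemma porbit_tperm i j : porbit (tperm i j) i = [set i; j].
Proof.
apply/setP => x; rewrite !inE; apply/porbitP/orP => [[n ->]|[]/eqP->].
- elim: n => [|n IHn]; first by rewrite expg0 perm1; left.
  rewrite expgSr permM; case: IHn => /eqP ->; rewrite ?tpermL ?tpermR eqxx; by [left | right].
- by exists 0; rewrite expg0 perm1.
- by exists 1; rewrite expg1 tpermL.
Qed.

Lemma transposition_cyclic i j : is_cyclic_perm (transposition i j).
Proof.
apply/and3P; split=> /=.
- by apply/set0Pn; exists i; rewrite !inE eqxx.
- exact: tperm_on.
apply/forall_inP => x; rewrite !inE => /orP[]/eqP->; first by rewrite porbit_tperm.
by rewrite tpermC porbit_tperm setUC.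
Qed.

Lemma fixed_cyclic i : is_cyclic_perm ([set i], 1%g : {perm A}).
Proof.
apply/and3P; split=> /=.
- by apply/set0Pn; exists i; rewrite inE.
- exact: perm_on1.
- apply/forall_inP => x; rewrite inE => /eqP ->.
  apply/eqP/setP=> y; rewrite inE; apply/porbitP/eqP => [[n ->]|->].
    by rewrite expg1n perm1.
  by exists 0; rewrite perm1.
Qed.

Definition cycle_of (u : {set A} * {perm A}) (cu : is_cyclic_perm u) : cyclic_perm A :=
  Sub u cu.

End Cycles.

(** * Existence *)

Section Extrema.

Variables (A : finType) (I : sf_instance A).
Implicit Types (i j k : A) (S : {set A}).

Lemma worstP i S : S != set0 ->
  worst I i S \in S /\ forall k, k \in S -> rank I i k <= rank I i (worst I i S).
Proof.
move=> /set0Pn[k0 k0S]; rewrite /worst; case: pickP => /= [k|/=].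
  by move=> /andP[kS /forall_inP kmax]; split=> // j /kmax; rewrite prefeq_rank.
case: (@arg_maxnP _ k0 (mem S) (rank I i) k0S) => w wS wmax /(_ w)/negP[].
by apply/andP; split=> //; apply/forall_inP => j /wmax; rewrite prefeq_rank.
Qed.

Definition best i S := odflt i [pick k in S | [forall x in S, rank I i k <= rank I i x]].

Lemma bestP i S : S != set0 ->
  best i S \in S /\ forall k, k \in S -> rank I i (best i S) <= rank I i k.
Proof.
move=> /set0Pn[k0 k0S]; rewrite /best; case: pickP => /= [k|/=].
  by move=> /andP[kS /forall_inP kmax].
case: (@arg_minnP _ k0 (mem S) (rank I i) k0S) => w wS wmin /(_ w)/negP[].
by apply/andP; split=> //; apply/forall_inP => j /wmin.
Qed.

End Extrema.

(** * The antitone map on sets of pairs *)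

Section Acceptable.

Variables (A : finType) (I : sf_instance A).
Implicit Types (i j k : A) (L : {set A * A}).

Definition col L i := [set k | (k, i) \in L].

(* [(i, j) \in L] reads "i accepts j", so that [col L i] is the set of agents
   willing to be matched with i. *)
Definition acceptable L : {set A * A} :=
  [set ij | (ij.1 != ij.2) && (above I ij.1 (col L ij.1) ij.2 < cap I ij.1)].

Lemma in_acceptable L i j :
  ((i, j) \in acceptable L) = (i != j) && (above I i (col L i) j < cap I i).
Proof. by rewrite inE. Qed.

Lemma colS L L' i : L \subset L' -> col L i \subset col L' i.
Proof. by move=> /subsetP LL'; apply/subsetP => k; rewrite !inE => /LL'. Qed.

Lemma acceptable_anti L L' : L \subset L' -> acceptable L' \subset acceptable L.
Proof.
move=> LL'; apply/subsetP => -[i j]; rewrite !in_acceptable => /andP[-> /=].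
exact/leq_ltn_trans/aboveS/colS.
Qed.

(** The empty set satisfies both inclusions, so a maximal solution exists. The square of
    [acceptable] is monotone and preserves both inclusions; applied to a maximal [L] it gives a
    solution containing [L], hence [L] itself. *)
Lemma maximal_acceptable : exists L,
  [/\ L \subset acceptable L, acceptable (acceptable L) = L &
    forall L', L \subset L' -> L' \subset acceptable L' ->
      L' \subset acceptable (acceptable L') -> L' = L].
Proof.
pose P L := (L \subset acceptable L) && (L \subset acceptable (acceptable L)).
have P0 : P set0 by rewrite /P !sub0set.
have [L /maxsetP[/andP[LF LFF] Lmax] _] := maxset_exists P0.
exists L; split=> // [|L' LL' L'F L'FF]; last by apply: Lmax; rewrite /P ?L'F.
apply: Lmax => //; apply/andP; split.
  exact/acceptable_anti/acceptable_anti.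
exact/acceptable_anti/acceptable_anti.
Qed.

End Acceptable.

(** * Arcs of a maximal solution *)

Section Maximal.

Variables (A : finType) (I : sf_instance A) (L U : {set A * A}).
Hypotheses (LU : L \subset U) (defU : U = acceptable I L) (defL : L = acceptable I U).
Implicit Types (i j k : A).

(** The asymmetry is deliberate: the arcs into an agent are the best of [col L], those out of it the
    best of [col U]. *)
Definition arc i j := ((i, j) \in L) && ((j, i) \in U).
Definition outs i := [set j | arc i j].
Definition ins i := [set j | arc j i].

Lemma memU i j : ((i, j) \in U) = (i != j) && (above I i (col L i) j < cap I i).
Proof. by rewrite {1}defU in_acceptable. Qed.

Lemma memL i j : ((i, j) \in L) = (i != j) && (above I i (col U i) j < cap I i).
Proof. by rewrite {1}defL in_acceptable. Qed.

Lemma L_U i j : (i, j) \in L -> (i, j) \in U.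
Proof. exact/subsetP. Qed.

Lemma U_irr i : (i, i) \notin U.
Proof. by rewrite memU eqxx. Qed.

Lemma L_down i j k : (i, j) \in L -> i != k -> rank I i k <= rank I i j -> (i, k) \in L.
Proof. by rewrite !memL => /andP[_ jc] -> /(above_mono (col U i)) /leq_ltn_trans; apply. Qed.

Lemma ins_top i : ins i = top I (cap I i) i (col L i).
Proof.
apply/setP => j; rewrite !inE /arc memU; have [jL|//] := boolP ((j, i) \in L).
by rewrite eq_sym; have [eij|//] := eqVneq j i; rewrite eij in jL; case/negP: (U_irr i); apply: L_U.
Qed.

Lemma outs_top i : outs i = top I (cap I i) i (col U i).
Proof.
apply/setP => j; rewrite !inE /arc andbC memL; have [jU|//] := boolP ((j, i) \in U).
by rewrite eq_sym; have [eij|//] := eqVneq j i; rewrite eij in jU; case/negP: (U_irr i).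
Qed.

Lemma card_ins_le_outs i : #|ins i| <= #|outs i|.
Proof.
rewrite ins_top outs_top !card_top leq_min geq_minl /=.
exact/(leq_trans (geq_minr _ _))/subset_leq_card/colS.
Qed.

(** Each arc is counted once at either end, so the termwise inequality [card_ins_le_outs] has equal
    sums. *)
Lemma card_ins_outs i : #|ins i| = #|outs i|.
Proof.
have sumE : \sum_j #|ins j| = \sum_j #|outs j|.
  under eq_bigr do rewrite -sum1_card big_mkcond.
  under [RHS]eq_bigr do rewrite -sum1_card big_mkcond.
  by rewrite exchange_big; do 2!apply: eq_bigr => ? _; rewrite !inE.
apply: (@sum_leq_eq _ predT _ _ (fun j _ => card_ins_le_outs j)) => //.
by rewrite sumE.
Qed.

Definition halved := [set i | ins i != outs i].

(** With free capacity, [ins i] is all of [col L i] and [outs i], of the same size, all of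
    [col U i]; inclusion and equal sizes then give [ins i = outs i]. *)
Lemma halved_full i : i \in halved -> #|ins i| = cap I i.
Proof.
rewrite inE ins_top outs_top => neq.
have := card_ins_outs i; rewrite ins_top outs_top !card_top.
have [//|ltc] := leqP (cap I i) #|col L i|.
have [_ ->//|_ eqc] := leqP (cap I i) #|col U i|.
case/negP: neq; apply/eqP; congr (top _ _ _ _); apply/eqP.
by rewrite eqEcard colS // eqc leqnn.
Qed.

(** If the tops of [col L i] and [col U i] coincide, either [col U i] is short and [i] admits
    everyone, or the common top is full and sets the same threshold for [U] and for [L]. *)
Lemma halved_U i j : (i, j) \in U -> (i, j) \notin L -> i \in halved.
Proof.
move=> ijU; apply: contraR; rewrite inE negbK ins_top outs_top => /eqP eqT.
move: ijU; rewrite memU memL => /andP[-> /=].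
have [capU /above_top |ltU _] := leqP (cap I i) #|col U i|; last exact: above_ltT.
rewrite eqT card_top (minn_idPl capU) => /(_ erefl) [w].
exact: top_above.
Qed.

Lemma halved_out i j : arc i j -> ~~ arc j i -> i \in halved.
Proof.
move=> ij nji; rewrite inE; apply/eqP => /setP/(_ j).
by rewrite !inE ij (negPf nji).
Qed.

Lemma halved_in i j : arc i j -> ~~ arc j i -> j \in halved.
Proof.
move=> ij nji; rewrite inE; apply/eqP => /setP/(_ i).
by rewrite !inE ij (negPf nji).
Qed.

(** * Rotation moves *)

Definition last_in i := worst I i (ins i).

Lemma last_inP i : i \in halved ->
  arc (last_in i) i /\ forall j, arc j i -> rank I i j <= rank I i (last_in i).
Proof.
move=> iH; have ins0 : ins i != set0.
  by rewrite -card_gt0 halved_full //; case/andP: (cap_bounds I i).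
have [] := worstP I i ins0; rewrite inE => ? wmax; split=> // j ji.
by apply: wmax; rewrite inE.
Qed.

Lemma U_last_in i j : i \in halved -> (i, j) \in U -> rank I i j <= rank I i (last_in i).
Proof.
move=> iH; have [_ wmax] := last_inP iH; rewrite memU => /andP[_ /above_top].
rewrite -ins_top halved_full // => /(_ erefl) [w].
by rewrite inE => /wmax /(leq_trans _) h /h.
Qed.

(** Accepting its worst predecessor in [L], [i] would accept all of them; then [ins i] would lie in
    [outs i] and equal it by size. *)
Lemma last_in_L i : i \in halved -> (i, last_in i) \notin L.
Proof.
move=> iH; apply/negP => wL; have [_ wmax] := last_inP iH.
move: (iH); rewrite inE eqEcard card_ins_outs leqnn andbT => /negP[].
apply/subsetP => j; rewrite !inE => ji; case/andP: (ji) => jiL ijU.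
rewrite /arc (L_U jiL) andbT; apply: L_down wL _ (wmax _ ji).
by apply: contraNneq (U_irr i) => {2}->.
Qed.

(** The target of the next proposal of [i] in a rotation move. For halved [i] the set is not empty,
    as [last_in i] is a candidate. *)
Definition next_out i := best I i (col U i :\: [set j | (i, j) \in L]).

Lemma next_outP i : i \in halved ->
  [/\ (next_out i, i) \in U, (i, next_out i) \notin L &
    forall j, (j, i) \in U -> (i, j) \notin L -> rank I i (next_out i) <= rank I i j].
Proof.
move=> iH; have [/andP[wiL _] _] := last_inP iH.
have ne : col U i :\: [set j | (i, j) \in L] != set0.
  by apply/set0Pn; exists (last_in i); rewrite !inE last_in_L ?L_U.
have [] := bestP I i ne; rewrite !inE => /andP[? ?] bmin; split=> // j jiU ijL.
by apply: bmin; rewrite !inE jiU ijL.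
Qed.

Lemma below_next_out i j : i \in halved -> (j, i) \in U ->
  rank I i j < rank I i (next_out i) -> arc i j.
Proof.
move=> iH jiU lt; have [_ _ pmin] := next_outP iH; rewrite /arc jiU andbT.
by apply: contraLR lt; rewrite -leqNgt; apply: pmin.
Qed.

Lemma next_out_U i : i \in halved -> (i, next_out i) \in U.
Proof.
move=> iH; have [piU _ pmin] := next_outP iH; have [/andP[wiL iwU] _] := last_inP iH.
move: iwU; rewrite !memU => /andP[_ /(leq_ltn_trans _)]; rewrite andbC => -> /=.
  by apply: contraNneq (U_irr i) => {1}->.
exact/above_mono/pmin/last_in_L/iH/L_U.
Qed.

Lemma next_out_halved i : i \in halved -> next_out i \in halved.
Proof.
move=> iH; have [piU ipL _] := next_outP iH; have ipU := next_out_U iH.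
have [piL|piL] := boolP ((next_out i, i) \in L); last exact: halved_U piU piL.
by apply: (@halved_out _ i); rewrite /arc ?piL ?(negPf ipL).
Qed.

Lemma last_in_halved i : i \in halved -> last_in i \in halved.
Proof.
move=> iH; have [wi _] := last_inP iH.
by apply: halved_out wi _; rewrite /arc (negPf (last_in_L iH)).
Qed.

(* A rotation move: if i also proposes to the next agent willing to take it, then
   that agent drops its worst proposer, who has to move in turn. *)
Definition step i := last_in (next_out i).

Lemma step_halved i : i \in halved -> step i \in halved.
Proof. by move=> iH; apply/last_in_halved/next_out_halved. Qed.

(* The arcs that are not in both directions form the cycles of length > 2. *)
Definition half_arc i j := arc i j && ~~ arc j i.

Lemma step_half_arc i : i \in halved -> half_arc (step i) (next_out i).
Proof.
move=> /next_out_halved pH; rewrite /half_arc; have [-> _] := last_inP pH.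
by rewrite /arc (negPf (last_in_L pH)).
Qed.

Lemma card_half i : #|[set j | half_arc i j]| = #|[set j | half_arc j i]|.
Proof.
have -> : [set j | half_arc i j] = outs i :\: ins i.
  by apply/setP => j; rewrite !inE andbC.
have -> : [set j | half_arc j i] = ins i :\: outs i.
  by apply/setP => j; rewrite !inE andbC.
by rewrite !cardsD setIC card_ins_outs.
Qed.

Definition tight i s := forall k, half_arc i k = (k == s).

(** A half arc from [j] to [k] has [(k, j)] outside [L], so the inclusion must come from the move of
    some [k] in [D], and injectivity leaves at most one. There is one, because the half arc from
    [last_in j] into [j] is balanced by one leaving [j]. *)
Lemma tight_full (D : {set A}) j : D \subset halved -> {in D &, injective next_out} ->
    j \in D -> outs j \subset col (L :|: [set (i, next_out i) | i in D]) j ->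
  exists s, [/\ s \in D, next_out s = j & tight j s].
Proof.
move=> /subsetP DH inj_p jD /subsetP sub.
have half_p k : half_arc j k -> k \in D /\ next_out k = j.
  move=> /andP[jk nkj]; have := sub k; rewrite !inE => /(_ jk)/orP[kjL|].
    by case/negP: nkj; case/andP: jk => jkL kjU; rewrite /arc kjL L_U.
  by case/imsetP => i iD [-> ->].
have : 0 < #|[set k | half_arc j k]|.
  rewrite card_half; apply/card_gt0P; exists (last_in j); rewrite inE.
  have jH := DH _ jD; rewrite /half_arc; have [-> _] := last_inP jH.
  by rewrite /arc (negPf (last_in_L jH)).
case/card_gt0P => s; rewrite inE => js; have [sD ps] := half_p s js.
exists s; split=> // k; apply/idP/eqP => [jk|-> //].
by have [kD pk] := half_p k jk; apply: inj_p => //; rewrite pk.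
Qed.

Hypothesis Lmax : forall L' : {set A * A}, L \subset L' -> L' \subset acceptable I L' ->
  L' \subset acceptable I (acceptable I L') -> L' = L.

(* Otherwise, adding all [(i, next_out i)] with [i \in D] to L contradicts its
   maximality. *)
Lemma exists_tight (D : {set A}) : D != set0 -> D \subset halved -> step @: D = D ->
  exists j s, [/\ j \in D, s \in D, next_out s = j & tight j s].
Proof.
move=> /set0Pn[d dD] sDH stepD; have DH := subsetP sDH.
have inj_step : {in D &, injective step} by apply/imset_injP; rewrite stepD.
have inj_p : {in D &, injective next_out}.
  by move=> x y xD yD eq_p; apply: inj_step; rewrite // /step eq_p.
set L' := L :|: [set (i, next_out i) | i in D].
have LL' : L \subset L' by apply: subsetUl.
have L'U : L' \subset U.
  rewrite subUset LU; apply/subsetP => _ /imsetP[i iD ->].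
  exact/next_out_U/DH.
have UL' : acceptable I L' \subset U by rewrite defU acceptable_anti.
have [/exists_inP[j jD sub]|no_tight] :=
    boolP [exists j in D, outs j \subset col L' j].
  by have [s [sD ps tj]] := tight_full sDH inj_p jD sub; exists j, s.
have : L' = L.
  apply: Lmax => //; last first.
    (* Inclusion in the square of [acceptable]. Write a moving [i] as [step x] and put
       [j = next_out x]: with [x] as a new proposer, [j] has [cap I j] proposers better than [i] and
       refuses it, so [j] frees a place among [outs i]. *)
    rewrite subUset {1}defL defU !acceptable_anti //=.
    apply/subsetP => _ /imsetP[i iD ->]; rewrite in_acceptable.
    have iH := DH _ iD; have := next_out_U iH; rewrite memU => /andP[-> _] /=.
    rewrite -stepD in iD; have [x xD def_i] := imsetP iD.
    have jH := next_out_halved (DH _ xD).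
    have [ij jmax] := last_inP jH; set j := next_out x in jH ij jmax.
    have wj : last_in j = i by [].
    rewrite wj in ij jmax; rewrite -(halved_full iH) card_ins_outs.
    have [jxU xjL _] := next_outP (DH _ xD); rewrite -/j in jxU xjL.
    have ijU' : (j, i) \notin acceptable I L'.
      rewrite in_acceptable negb_and orbC -leqNgt; apply/orP; left.
      have -> : cap I j = #|x |: ins j :\ i|.
        rewrite -(halved_full jH) cardsU1 (cardsD1 i (ins j)).
        by rewrite !inE ij /arc (negPf xjL) andbF.
      apply/subset_leq_card/subsetP => k; rewrite !inE => /orP[/eqP ->|].
        rewrite imset_f ?orbT //= ltn_neqAle (inj_eq (@rank_inj _ _ _)).
        rewrite -{2}wj U_last_in // andbT; apply: contraNneq xjL => ->.
        by case/andP: ij.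
      move=> /andP[nki kj]; case/andP: (kj) => -> _ /=.
      by rewrite ltn_neqAle (inj_eq (@rank_inj _ _ _)) nki jmax.
    apply: proper_card; apply/properP; split.
      apply/subsetP => k; rewrite inE => /andP[kL' lt]; rewrite inE.
      by apply: below_next_out lt => //; apply: (subsetP UL'); rewrite inE in kL'.
    by exists j; rewrite inE // [_ \in col _ _]inE (negPf ijU').
  (* Inclusion in [acceptable I L']: by [no_tight] some agent of [outs i] is missing from
     [col L' i], which leaves room for [next_out i]. *)
  rewrite subUset {1}defL acceptable_anti //=.
  apply/subsetP => _ /imsetP[i iD ->]; rewrite in_acceptable.
  have iH := DH _ iD; have := next_out_U iH; rewrite memU => /andP[-> _] /=.
  rewrite -(halved_full iH) card_ins_outs; apply: proper_card; apply/properP; split.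
    apply/subsetP => k; rewrite !inE => /andP[kL' lt]; apply: below_next_out lt => //.
    by apply: (subsetP L'U); rewrite !inE.
  have /exists_inPn/(_ i iD)/subsetPn[k ki nk] := no_tight.
  by exists k => //; rewrite inE (negPf nk).
move=> eqL; have [_ + _] := next_outP (DH _ dD).
by rewrite -eqL !inE imset_f ?orbT.
Qed.

(** Such a [j] is no worse than [last_in i] and no better than [next_out i]; here the two bounds
    coincide. *)
Lemma pinned i j : i \in halved -> next_out i = last_in i ->
  (i, j) \in U -> (j, i) \in U -> (i, j) \notin L -> j = last_in i.
Proof.
move=> iH pw ijU jiU ijL; apply/(@rank_inj _ I i)/eqP; rewrite eqn_leq U_last_in //=.
by rewrite -pw; have [_ _] := next_outP iH; apply.
Qed.

Lemma half_arcE i j : half_arc i j = [&& (i, j) \in L, (j, i) \in U & (j, i) \notin L].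
Proof.
rewrite /half_arc /arc -andbA; have [ijL|//] := boolP ((i, j) \in L).
by rewrite (L_U ijL) andbT.
Qed.

Lemma pinned_half_in i j : i \in halved -> next_out i = last_in i ->
  half_arc j i -> j = last_in i.
Proof. by move=> iH pw; rewrite half_arcE => /and3P[/L_U ? ? ?]; apply: pinned. Qed.

(** Otherwise neither of [i] and [next_out i] accepts the other in [L], and [pinned] makes [i] the
    worst predecessor of [next_out i]; but a predecessor accepts in [L]. *)
Lemma pinned_next_out i : i \in halved ->
  next_out (next_out i) = last_in (next_out i) -> half_arc (next_out i) i.
Proof.
move=> iH pw; have [piU ipL _] := next_outP iH; have pH := next_out_halved iH.
rewrite half_arcE ipL next_out_U // !andbT; apply: contraNT ipL => npiL.
have {1}-> := pinned pH pw piU (next_out_U iH) npiL.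
by have [/andP[]] := last_inP pH.
Qed.

(** Tightness passes from [(j, s)] back to [(s, i)]: tightness of [j] forces [next_out i = s], so
    [next_out s] and [last_in s] are both [j]. Then [s] has at most one half arc in, hence at most
    one out, and there is one to [i]. *)
Lemma tight_step i j s : i \in halved -> s \in halved ->
  next_out s = j -> tight j s -> step i = j ->
  [/\ next_out i = s, last_in s = j & tight s i].
Proof.
move=> iH sH ps tj def_j.
have pi : next_out i = s by apply/eqP; rewrite -tj -def_j step_half_arc.
have ws : last_in s = j by rewrite -pi.
have si : half_arc s i by rewrite -pi pinned_next_out // pi ps ws.
split=> // k; have : #|[set l | half_arc s l]| <= 1.
  rewrite card_half -(cards1 j); apply/subset_leq_card/subsetP => l; rewrite !inE -ws.
  by move=> /pinned_half_in-> //; rewrite ps.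
move=> card1; have /eqP/setP/(_ k) : [set i] == [set l | half_arc s l].
  by rewrite eqEcard sub1set inE si cards1.
by rewrite !inE => ->.
Qed.

(** * Minimal sets closed under rotation moves *)

Definition invariant (D : {set A}) :=
  [&& D != set0, D \subset halved & step @: D \subset D].

Definition ring D := minset invariant D.

Lemma ring_halved D i : ring D -> i \in D -> i \in halved.
Proof. by case/minsetP=> /and3P[_ /subsetP DH _] _; apply: DH. Qed.

Lemma ring_sub D E : ring D -> E != set0 -> E \subset D ->
  {in E, forall i, step i \in E} -> E = D.
Proof.
case/minsetP=> /and3P[_ DH _] Dmin E0 ED stepE; apply: Dmin => //.
rewrite /invariant E0 (subset_trans ED) //=.
by apply/subsetP => _ /imsetP[i iE ->]; apply: stepE.
Qed.

Lemma ring_neq0 D : ring D -> D != set0.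
Proof. by case/minsetP=> /and3P[]. Qed.

Lemma ring_step D : ring D -> step @: D = D.
Proof.
move=> rD; have [/and3P[/set0Pn[i iD] _ stepD] _] := minsetP rD.
apply: ring_sub => // [|j jD]; last exact/imset_f/(subsetP stepD).
by apply/set0Pn; exists (step i); apply: imset_f.
Qed.

(** [exists_tight] supplies one tight agent. Two uses of [tight_step] carry tightness from [step x]
    to [x], so the agents that are not tight are closed under [step]; by minimality there are
    none. *)
Lemma ring_tight D i : ring D -> i \in D ->
  exists s, [/\ s \in D, tight i s, next_out s = i, next_out i = last_in i & last_in s = i].
Proof.
move=> rD; have DH := ring_halved rD; have stepD := ring_step rD.
have DS x : x \in D -> step x \in D by move=> xD; rewrite -stepD imset_f.
pose isbad j s := [&& j \in D, s \in D, next_out s == j & [forall k, half_arc j k == (k == s)]].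
have badP j s : reflect [/\ j \in D, s \in D, next_out s = j & tight j s] (isbad j s).
  apply: (iffP and4P) => [[jD sD /eqP ps /forallP ts]|[jD sD /eqP ps ts]]; split=> //.
    by move=> k; apply/eqP.
  by apply/forallP => k; rewrite ts.
have bad_step x j s : isbad j s -> x \in D -> step x = j ->
    [/\ isbad s x, next_out x = s & last_in s = j].
  move=> /badP[jD sD ps tj] xD stepx.
  have [-> -> ts] := tight_step (DH _ xD) (DH _ sD) ps tj stepx; split=> //.
  by apply/badP; split=> //; have [] := tight_step (DH _ xD) (DH _ sD) ps tj stepx.
have pred_step x : x \in D -> exists2 y, y \in D & step y = x.
  by rewrite -{1}stepD => /imsetP[y yD ->]; exists y.
pose B := [set j in D | [exists s, isbad j s]].
have BE : B = D.
  have BD : B \subset D by apply/subsetP => j; rewrite inE => /andP[].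
  have [/eqP|DB0] := eqVneq (D :\: B) set0.
    by rewrite setD_eq0 => DB; apply/eqP; rewrite eqEsubset BD.
  have DBE : D :\: B = D.
    apply: ring_sub => // [|x]; first exact: subsetDl.
    rewrite [x \in _]inE => /andP[xB xD]; rewrite inE DS // andbT.
    apply: contra xB; rewrite inE => /andP[_ /existsP[s js]].
    have [sx _ _] := bad_step x _ _ js xD erefl.
    have /badP[_ sD _ _] := js; have [y yD stepy] := pred_step s sD.
    have [xy _ _] := bad_step y _ _ sx yD stepy.
    by rewrite inE xD; apply/existsP; exists y.
  have /set0Pn[d dD] := ring_neq0 rD.
  have sDH : D \subset halved by apply/subsetP.
  have [j [s [jD sD ps tj]]] := exists_tight (ring_neq0 rD) sDH stepD.
  have : j \in D :\: B by rewrite DBE.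
  rewrite !inE jD andbT /= => /negP[]; apply/existsP; exists s.
  exact/badP.
move=> iD; have := DS _ iD; rewrite -{1}BE inE => /andP[_ /existsP[t yt]].
have [ti pi wt] := bad_step i _ _ yt iD erefl.
have /badP[_ tD _ _] := yt; have [x xD stepx] := pred_step t tD.
have [/badP[_ _ px ix] _ wi] := bad_step x _ _ ti xD stepx.
exists x; split=> //; first by rewrite pi wi.
have [z zD stepz] := pred_step i iD.
have ix' : isbad i x by apply/badP.
by have [_ _ ->] := bad_step z _ _ ix' zD stepz.
Qed.

(** Tightness of [step i] puts [next_out i] into the ring, where agents are pinned; so [i] is the
    target of its only half arc, and this target is in the ring. *)
Lemma ring_closed D i : ring D -> i \in halved -> step i \in D -> i \in D.
Proof.
move=> rD iH /(ring_tight rD)[s [sD ts _ _ _]].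
have pi : next_out i = s by apply/eqP; rewrite -ts step_half_arc.
have [k [kD tk _ pw _]] := ring_tight rD sD.
have := pinned_next_out iH; rewrite pi => /(_ pw); rewrite tk => /eqP ->.
exact: kD.
Qed.

(** By [ring_closed], the halved agents outside all rings are closed under [step]; if there were
    any, they would contain a ring. *)
Lemma halved_ring i : i \in halved -> exists2 D, ring D & i \in D.
Proof.
move=> iH; suff /exists_inP[D rD iD] : [exists D in ring, i \in D] by exists D.
apply/contraT => nr.
pose E := [set j in halved | ~~ [exists D in ring, j \in D]].
have invE : invariant E.
  apply/and3P; split; first by apply/set0Pn; exists i; rewrite inE iH.
    by apply/subsetP => j; rewrite inE => /andP[].
  apply/subsetP => _ /imsetP[j + ->]; rewrite inE => /andP[jH].
  rewrite [_ \in E]inE step_halved //; apply: contra => /exists_inP[D rD jD].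
  by apply/exists_inP; exists D => //; apply: ring_closed jD.
have [D rD DE] := minset_exists invE.
have /set0Pn[d dD] := ring_neq0 rD.
have := subsetP DE _ dD; rewrite inE => /andP[_ /exists_inPn/(_ D rD)].
by rewrite dD.
Qed.

Lemma halved_pinned i : i \in halved -> next_out i = last_in i.
Proof. by case/halved_ring=> D rD /(ring_tight rD)[s []]. Qed.

Lemma halved_tight i : i \in halved ->
  exists s, [/\ s \in halved, tight i s & last_in s = i].
Proof.
case/halved_ring=> D rD /(ring_tight rD)[s [sD ts _ _ ws]].
by exists s; split=> //; apply: ring_halved sD.
Qed.

Lemma U_L i j : (i, j) \in U -> (j, i) \in U -> ((i, j) \in L) || ((j, i) \in L).
Proof.
move=> ijU jiU; apply/orP; have [|ijL] := boolP ((i, j) \in L); [by left | right].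
have iH := halved_U ijU ijL.
rewrite (pinned iH (halved_pinned iH) ijU jiU ijL).
by have [/andP[]] := last_inP iH.
Qed.

(* On the agents with half arcs, [step] is the square of this permutation, which
   is why its cycles are odd. *)
Definition cycle_fun i := if i \in halved then last_in i else i.

Lemma cycle_fun_inj : injective cycle_fun.
Proof.
move=> i j; rewrite /cycle_fun; case: ifP => iH; case: ifP => jH eq_ij.
- have wH := last_in_halved iH; have [s [_ ts _]] := halved_tight wH.
  have half_w k : k \in halved -> half_arc (last_in k) k.
    move=> kH; rewrite /half_arc; have [-> _] := last_inP kH.
    by rewrite /arc (negPf (last_in_L kH)).
  have := half_w i iH; have := half_w j jH; rewrite -eq_ij !ts => /eqP-> /eqP ->.
  by [].
- by rewrite -eq_ij last_in_halved in jH.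
- by rewrite eq_ij last_in_halved in iH.
- by [].
Qed.

Definition cycle_perm := perm cycle_fun_inj.

Lemma cycle_permE i : cycle_perm i = cycle_fun i.
Proof. by rewrite permE. Qed.

(** The agent [s] with [last_in s = i] is in the ring of [i], so [n] steps, which are [n.*2]
    applications of [cycle_perm], lead from [i] to [s]; one more application returns to [i]. *)
Lemma odd_ring i : i \in halved -> exists n, iter n.*2.+1 cycle_perm i = i.
Proof.
move=> iH; have [D rD iD] := halved_ring iH.
have [s [sD ti _ _ ws]] := ring_tight rD iD.
have iter_step n : iter n step i \in D.
  by elim: n => //= n IHn; rewrite -(ring_step rD) imset_f.
have iterE n : iter n step i = iter n.*2 cycle_perm i.
  elim: n => // n IHn; rewrite iterS doubleS !iterS -IHn !cycle_permE.
  have nD := iter_step n; have nH := ring_halved rD nD.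
  by rewrite /cycle_fun nH last_in_halved // -{1}(halved_pinned nH).
pose E := [set j in D | fconnect step i j].
have ED : E = D.
  apply: ring_sub => // [||j]; first by apply/set0Pn; exists i; rewrite inE iD connect0.
    by apply/subsetP => j; rewrite inE => /andP[].
  rewrite !inE => /andP[jD ij]; rewrite -(ring_step rD) imset_f //=.
  exact/(connect_trans ij)/fconnect1.
move: (sD); rewrite -ED inE => /andP[_ /iter_findex].
rewrite iterE; set n := findex _ _ _ => def_s; exists n.
by rewrite iterS def_s cycle_permE /cycle_fun (ring_halved rD sD).
Qed.

(** * The GSP formed by the arcs *)

Definition succ_perm := (cycle_perm^-1)%g.

Lemma succ_permP i : i \in halved ->
  [/\ succ_perm i \in halved, half_arc i (succ_perm i) & tight i (succ_perm i)].
Proof.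
move=> /halved_tight[s [sH ts ws]].
have -> : succ_perm i = s.
  have <- : cycle_perm s = i by rewrite cycle_permE /cycle_fun sH.
  exact: permK.
by split=> //; rewrite ts.
Qed.

Lemma succ_last_in i : i \in halved -> succ_perm (last_in i) = i.
Proof.
by move=> iH; rewrite -(_ : cycle_perm i = last_in i) ?permK // cycle_permE /cycle_fun iH.
Qed.

Lemma porbit_halved i j : i \in halved -> j \in porbit succ_perm i -> j \in halved.
Proof.
move=> iH /porbitP[n ->]; elim: n => [|n IHn]; first by rewrite expg0 perm1.
by rewrite expgSr permM; case: (succ_permP IHn).
Qed.

Definition half_cycle i := (porbit succ_perm i, restr_perm (porbit succ_perm i) succ_perm).

(** Each arc lies on exactly one of these cycles, by [is_long_ex] and [is_long_inj]. *)
Definition is_long (p : cyclic_perm A) :=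
  [exists i, exists j, [&& arc i j, arc j i & val p == transposition i j]]
  || [exists i in halved, val p == half_cycle i].

Lemma arc_neq i j : arc i j -> i != j.
Proof. by case/andP=> /L_U ijU _; apply: contraNneq (U_irr i) => {2}->. Qed.

Lemma is_longP p i : is_long p -> i \in cset p ->
  [/\ arc i (cperm p i), arc (cperm p i) i, val p = transposition i (cperm p i)
    & (cperm p)^-1%g i = cperm p i] \/
  [/\ i \in halved, val p = half_cycle i, cperm p i = succ_perm i
    & (cperm p)^-1%g i = last_in i].
Proof.
rewrite /cset /cperm => /orP[/existsP[a /existsP[b /and3P[ab ba /eqP ->]]]|].
  rewrite !inE => /orP[] /eqP->; left; rewrite /= tpermV ?tpermL ?tpermR; split=> //.
  by rewrite /transposition setUC tpermC.
case/exists_inP=> k kH /eqP-> /= ik; right; have iH := porbit_halved kH ik.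
have eq_orb : porbit succ_perm i = porbit succ_perm k by apply/eqP; rewrite eq_porbit_mem.
rewrite /half_cycle eq_orb restr_porbitE //; split=> //.
have wk : last_in i \in porbit succ_perm k by rewrite -mem_porbit_perm succ_last_in.
by rewrite -{1}(succ_last_in iH) -(restr_porbitE wk) permK.
Qed.

Lemma is_long_arc p i : is_long p -> i \in cset p ->
  arc i (cperm p i) /\ arc ((cperm p)^-1%g i) i.
Proof.
move=> lp /(is_longP lp)[[? ? _ ->]|[iH _ -> ->]] //.
have [_ /andP[-> _] _] := succ_permP iH.
by have [] := last_inP iH.
Qed.

Lemma is_long_inj i p q : is_long p -> is_long q -> i \in cset p -> i \in cset q ->
  cperm p i = cperm q i -> p = q.
Proof.
move=> lp lq ip iq eqi; apply: val_inj.
have [[_ b1 -> _]|[i1 -> s1 _]] := is_longP lp ip;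
  have [[_ b2 -> _]|[i2 -> s2 _]] := is_longP lq iq => //.
- by rewrite eqi.
- have [_ /andP[_ /negP nsi] _] := succ_permP i2; case: nsi.
  by rewrite -s2 -eqi.
- have [_ /andP[_ /negP nsi] _] := succ_permP i1; case: nsi.
  by rewrite -s1 eqi.
Qed.

Lemma is_long_ex i j : arc i j -> exists p, [/\ is_long p, i \in cset p & cperm p i = j].
Proof.
move=> ij; have [ji|nji] := boolP (arc j i).
  exists (cycle_of (transposition_cyclic i j)); split.
  - by apply/orP; left; apply/existsP; exists i; apply/existsP; exists j; rewrite ij ji /=.
  - by rewrite !inE eqxx.
  - exact: tpermL.
have iH := halved_out ij nji.
exists (cycle_of (porbit_cyclic succ_perm i)); split.
- by apply/orP; right; apply/exists_inP; exists i.
- exact: porbit_id.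
rewrite /cperm /= restr_porbitE ?porbit_id //; have [_ _ ti] := succ_permP iH.
by apply/eqP; rewrite eq_sym -ti /half_arc ij.
Qed.

Lemma is_long_card p : is_long p -> 1 < #|cset p|.
Proof.
move=> lp; have /andP[/set0Pn[i ip] /andP[onp _]] := valP p.
have [/arc_neq nip _] := is_long_arc lp ip; rewrite -(_ : #|[set i; cperm p i]| = 2).
  apply/subset_leq_card/subsetP => x; rewrite !inE => /orP[] /eqP-> //.
  by rewrite (perm_closed _ onp).
by rewrite cards2 nip.
Qed.

Definition fixed_cycle i : cyclic_perm A := cycle_of (fixed_cyclic i).

Lemma cset_fixed_cycle i : cset (fixed_cycle i) = [set i]. Proof. by []. Qed.

(** Fixed points fill the capacity that the arcs leave free. *)
Definition maximal_gsp :=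
  enum is_long ++ flatten [seq nseq (cap I i - #|outs i|) (fixed_cycle i) | i <- enum A].

Lemma mem_maximal_gsp p : p \in maximal_gsp ->
  is_long p \/ exists2 i, p = fixed_cycle i & #|outs i| < cap I i.
Proof.
rewrite mem_cat mem_enum => /orP[|/flattenP[_ /mapP[i _ ->]]]; first by left.
by rewrite mem_nseq subn_gt0 => /andP[? /eqP->]; right; exists i.
Qed.

Lemma is_long_maximal_gsp p : is_long p -> p \in maximal_gsp.
Proof. by move=> lp; rewrite mem_cat; apply/orP; left; rewrite mem_enum. Qed.

Lemma count_fixed (a : pred (cyclic_perm A)) :
  count a (flatten [seq nseq (cap I i - #|outs i|) (fixed_cycle i) | i <- enum A]) =
  \sum_i a (fixed_cycle i) * (cap I i - #|outs i|).
Proof.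
rewrite count_flatten -(map_comp (count a)) sumnE big_map big_enum /=.
by apply: eq_bigr => i _; rewrite /= count_nseq.
Qed.

Lemma card_outs_cap i : #|outs i| <= cap I i.
Proof. by rewrite outs_top card_top geq_minl. Qed.

Lemma count_maximal_gsp i : count (fun p => i \in cset p) maximal_gsp = cap I i.
Proof.
rewrite count_cat count_fixed (bigD1 i) //= big1 => [|j nji]; last first.
  by rewrite cset_fixed_cycle inE eq_sym (negPf nji).
rewrite cset_fixed_cycle inE eqxx mul1n addn0.
(* Sending a long cycle through [i] to the successor of [i] is a bijection onto [outs i]. *)
suff -> : count (fun p => i \in cset p) (enum is_long) = #|outs i|.
  by rewrite subnKC // card_outs_cap.
pose S := [set p | is_long p & i \in cset p].
have -> : count (fun p => i \in cset p) (enum is_long) = #|S|.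
  rewrite -size_filter cardE /enum_mem -filter_predI; congr size.
  by apply: eq_filter => p; rewrite !inE andbC.
rewrite -(card_in_imset (f := fun p => cperm p i)); last first.
  by move=> p q; rewrite !inE => /andP[lp ip] /andP[lq iq]; apply: is_long_inj.
apply: eq_card => j; rewrite inE; apply/imsetP/idP => [[p + ->]|/is_long_ex[p [lp ip pi]]].
  by rewrite inE => /andP[lp ip]; case: (is_long_arc lp ip).
by exists p; rewrite // inE lp.
Qed.

Lemma count_image i j : i != j -> count (fun p => cperm p i == j) maximal_gsp <= 1.
Proof.
move=> nij; rewrite count_cat count_fixed big1 ?addn0; last first.
  by move=> k _; rewrite /cperm /= perm1 (negPf nij).
rewrite -size_filter.
have Sarc p : p \in [seq p <- enum is_long | cperm p i == j] ->
    [/\ is_long p, i \in cset p & cperm p i = j].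
  rewrite mem_filter mem_enum => /andP[/eqP pi lp]; split=> //.
  have /and3P[_ onp _] := valP p; apply: contraNT nij => ip.
  by rewrite -pi /cperm (out_perm onp).
have : uniq [seq p <- enum is_long | cperm p i == j] by rewrite filter_uniq ?enum_uniq.
case: [seq _ <- _ | _] Sarc => [|p [|q s]] Sarc //= /andP[+ _].
have [lp ip pi] := Sarc p (mem_head _ _).
have [|lq iq qi] := Sarc q; first by rewrite !inE eqxx orbT.
by rewrite (is_long_inj lp lq ip iq) ?pi ?qi // mem_head.
Qed.

(** A predecessor of [i] on a long cycle is in the top of [col L i], so [i] accepts in [U]
    everything better; a fixed point signals free capacity, and then [i] accepts everyone else. *)
Lemma maximal_gsp_U p i j : p \in maximal_gsp -> i \in cset p -> i != j ->
  pref I i j ((cperm p)^-1%g i) -> (i, j) \in U.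
Proof.
rewrite pref_rank => pPi ip nij lt; rewrite memU nij /=.
have [lp|[k def_p ltk]] := mem_maximal_gsp pPi; last first.
  move: ip; rewrite def_p cset_fixed_cycle inE => /eqP ->.
  have := ltk; rewrite -card_ins_outs ins_top card_top gtn_min ltnn /=.
  exact: above_ltT.
have [_ pi] := is_long_arc lp ip; apply: top_above (ltnW lt).
by rewrite -ins_top inE.
Qed.

Lemma transposition_maximal_gsp i j : arc i j -> arc j i ->
  transposition i j \in [seq val p | p <- maximal_gsp].
Proof.
move=> ij ji; have [p [lp ip pi]] := is_long_ex ij.
have [[_ _ def_p _]|[iH _ si _]] := is_longP lp ip.
  by rewrite -pi -def_p; apply: map_f; apply: is_long_maximal_gsp.
have [_ /andP[_ /negP nsi] _] := succ_permP iH; case: nsi.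
by rewrite -si pi.
Qed.

(** The half arc comes from [last_in j], the worst predecessor, and [j] is full, so it is not a
    fixed point of the collection. *)
Lemma half_arc_pref p i j : p \in maximal_gsp -> j \in cset p -> half_arc i j ->
  pref I j i ((cperm p)^-1%g j) = false.
Proof.
move=> pPi jp ij; have jH : j \in halved by case/andP: ij => /halved_in; apply.
rewrite (pinned_half_in jH (halved_pinned jH) ij) pref_rank.
apply/negbTE; rewrite -leqNgt; have [_ wmax] := last_inP jH.
have [lp|[k def_p ltk]] := mem_maximal_gsp pPi.
  by apply: wmax; case: (is_long_arc lp jp).
move: jp; rewrite def_p cset_fixed_cycle inE => /eqP def_j.
by have := halved_full jH; rewrite card_ins_outs def_j => eqk; rewrite eqk ltnn in ltk.
Qed.

Lemma maximal_gspP : is_gsp I maximal_gsp.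
Proof.
split.
- rewrite filter_cat cat_uniq filter_uniq ?enum_uniq //=.
  rewrite (_ : [seq p <- flatten _ | _] = [::]) //; apply/eqP; rewrite -size_eq0 size_filter.
  by rewrite count_fixed big1 // => i _; rewrite cset_fixed_cycle cards1.
- move=> p i /mem_maximal_gsp[lp ip|[k -> _] _]; last first.
    by rewrite prefeq_rank /cperm /= invg1 perm1.
  have [[_ _ _ ->]|[iH _ -> ->]] := is_longP lp ip; first by rewrite prefeq_rank.
  rewrite prefeq_rank leqNgt; apply: contra (last_in_L iH) => /ltnW le.
  have [_ /andP[sL _] _] := succ_permP iH; case/andP: sL => sL _; apply: L_down sL _ le.
  by have [/arc_neq] := last_inP iH; rewrite eq_sym.
(* A pair violating F2 is in [U] both ways, hence in [L] at least one way. If only one way, it is a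
   half arc, against [half_arc_pref]; if both ways, its transposition is present. *)
- case=> i [j [nij ntrans [p [q [[pPi qPi] [ip jq] ijp jiq]]]]].
  have ijU := maximal_gsp_U pPi ip nij ijp.
  have nji : j != i by rewrite eq_sym.
  have jiU := maximal_gsp_U qPi jq nji jiq.
  have {}ijL : (i, j) \in L.
    have /orP[//|jiL] := U_L ijU jiU; apply/contraT => nijL.
    have := half_arc_pref pPi ip (_ : half_arc j i); rewrite half_arcE jiL ijU nijL.
    by move=> /(_ isT); rewrite ijp.
  have {}jiL : (j, i) \in L.
    apply/contraT => njiL.
    have := half_arc_pref qPi jq (_ : half_arc i j); rewrite half_arcE ijL jiU njiL.
    by move=> /(_ isT); rewrite jiq.
  by case/negP: ntrans; apply: transposition_maximal_gsp; rewrite /arc ?ijL ?jiL ?ijU ?jiU.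
- exact: count_maximal_gsp.
- move=> i j nij; rewrite (leq_trans (leq_add (count_image nij) (count_image _))) //.
  by rewrite eq_sym.
Qed.

Lemma maximal_gsp_odd i : i \in halved ->
  exists p, [/\ p \in maximal_gsp, odd #|cset p| & 1 < #|cset p|].
Proof.
move=> iH; have [_ /andP[is_arc nsi] _] := succ_permP iH.
have [p [lp ip pi]] := is_long_ex is_arc.
exists p; rewrite is_long_maximal_gsp // is_long_card //; split=> //.
have [[_]|[_ def_p _ _]] := is_longP lp ip; first by rewrite pi (negPf nsi).
rewrite /cset def_p /= porbitV; have [n /porbit_dvdn dv] := odd_ring iH.
by rewrite (dvdn_odd dv) //= odd_double.
Qed.

(** Here [L = U], so arcs are symmetric and form the matching. Acceptance implies membership in [U],
    so a blocking pair would already be matched. *)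
Lemma stable_of_unhalved : halved = set0 -> exists M, stable_matching I M.
Proof.
move=> H0; have UL i j : (i, j) \in U -> (i, j) \in L.
  by move=> ijU; apply/contraT => /(halved_U ijU); rewrite H0 inE.
have arc_sym i j : arc i j -> arc j i.
  by rewrite /arc => /andP[/L_U -> /UL ->].
pose M := [set e | [exists i, exists j, arc i j && (e == [set i; j])]].
have M2 e : e \in M -> #|e| = 2.
  rewrite inE => /existsP[i /existsP[j /andP[/arc_neq nij /eqP ->]]].
  by rewrite cards2 nij.
have memM i j : ([set i; j] \in M) = arc i j.
  apply/idP/idP => [ijM|ij]; last first.
    by rewrite inE; apply/existsP; exists i; apply/existsP; exists j; rewrite ij /=.
  have nij : i != j by have := M2 _ ijM; rewrite cards2; case: eqP.
  move: ijM; rewrite inE => /existsP[a /existsP[b /andP[ab /eqP/setP eq_e]]].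
  have := eq_e i; have := eq_e j; rewrite !inE !eqxx orbT /=.
  move=> /esym/orP[] /eqP ej /esym/orP[] /eqP ei; rewrite ei ej // in nij *.
  - by rewrite eqxx in nij.
  - exact: arc_sym.
  - by rewrite eqxx in nij.
have partnersE i : partners M i = ins i.
  by apply/setP => j; rewrite inE memM inE; apply/idP/idP => /arc_sym.
have acceptsU i j : i != j -> accepts I M i j -> (i, j) \in U.
  rewrite /accepts partnersE memU => -> /= /orP[|].
    by rewrite ins_top card_top gtn_min ltnn /=; apply: above_ltT.
  (* Without partners, [worst] is only a default value; but then [col L i] is empty, as the capacity
     is positive. *)
  have [ins0 _|/(worstP I i)[wi _]] := eqVneq (ins i) set0.
    have := card_top I (cap I i) i (col L i); rewrite -ins_top ins0 cards0.
    by case/andP: (cap_bounds I i) => cap0 _ min0; apply: above_ltT; lia.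
  by rewrite pref_rank ins_top in wi * => /ltnW; apply: top_above.
exists M; split; first split=> // i.
  by rewrite card_partners // partnersE card_ins_outs card_outs_cap.
move=> i j; apply/and4P => -[nij ijM aji aij].
have nji : j != i by rewrite eq_sym.
by rewrite memM /arc (UL _ _ (acceptsU _ _ nij aij)) acceptsU in ijM.
Qed.

End Maximal.

(** * Comparison *)

Section Comparison.

Variables (E V : finType) (u v : E -> V) (c : V -> nat) (rk : V -> E -> nat).
Hypothesis uv : forall e, u e != v e.
Implicit Types (e f : E) (x : V) (S N M : {set E}).

Definition incident S x := [set e in S | (u e == x) || (v e == x)].

(* [S] leaves no room for [e] at its end [x]. *)
Definition dominates S x e :=
  (c x <= #|incident S x|) && [forall f in incident S x, rk x f < rk x e].

(* With a_x and b_x the numbers of edges of N \ M and M \ N at x, and p_x and q_x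
   those among them dominated at x by the other set: p_x + q_x is at most a_x and
   at most b_x, whereas its sum over x is at least |N \ M| + |M \ N|. Since a_x
   and b_x sum to 2 |N \ M| and 2 |M \ N|, all these bounds are equalities. *)
Definition dominated N M x := [set e in incident (N :\: M) x | dominates M x e].

Lemma incidentD N M x : incident (N :\: M) x = incident N x :\: incident M x.
Proof. by apply/setP => e; rewrite !inE; case: (_ || _); rewrite ?andbT ?andbF. Qed.

Lemma sum_incident S (P : V -> pred E) :
  \sum_x #|[set e in incident S x | P x e]| = \sum_(e in S) (P (u e) e + P (v e) e).
Proof.
under eq_bigr do rewrite -sum1_card big_mkcond.
rewrite exchange_big [RHS]big_mkcond; apply: eq_bigr => e _ /=.
rewrite (bigD1 (u e)) //= (bigD1 (v e)) 1?eq_sym //= big1 => [|x /andP[xu xv]].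
  by rewrite !inE !eqxx orbT addn0; case: (e \in S); case: (P _ e); case: (P _ e).
by rewrite !inE ![_ == x]eq_sym (negPf xu) (negPf xv) andbF.
Qed.

(** An edge of either kind at [x] would have to be strictly better than the other. *)
Lemma dominated_excl N M x : dominated N M x = set0 \/ dominated M N x = set0.
Proof.
have [->|/set0Pn[e]] := eqVneq (dominated M N x) set0; first by right.
rewrite inE incidentD inE => /andP[/andP[eN eM] /andP[cN /forall_inP Ne]]; left.
apply/setP => f; rewrite [in RHS]inE; apply/negP; rewrite inE incidentD inE.
move=> /andP[/andP[_ fN] /andP[_ /forall_inP/(_ e eM)]].
by rewrite ltnNge ltnW ?Ne.
Qed.

(** If [dominated M N x] is not empty, the other set is, and [N] fills the capacity of [x]; so at
    [x] the set [M :\: N] has no more edges than [N :\: M]. *)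
Lemma dominated_le N M x :
    #|incident N x| <= c x -> #|incident M x| <= c x ->
  #|dominated N M x| + #|dominated M N x| <= #|incident (N :\: M) x|.
Proof.
move=> Nc Mc; have [->|/set0Pn[e eMN]] := eqVneq (dominated M N x) set0.
  rewrite cards0 addn0; apply/subset_leq_card/subsetP => e.
  by rewrite inE => /andP[].
have -> : dominated N M x = set0.
  by have [//|MN0] := dominated_excl N M x; rewrite MN0 inE in eMN.
move: eMN; rewrite inE => /andP[_ /andP[cN _]].
rewrite cards0 add0n.
apply: (@leq_trans #|incident (M :\: N) x|).
  by apply/subset_leq_card/subsetP => f; rewrite inE => /andP[].
rewrite !incidentD !cardsD setIC.
by have := subset_leq_card (subsetIl (incident N x) (incident M x)); lia.
Qed.

Lemma dominated_eq N M :
    (forall x, #|incident N x| <= c x) -> (forall x, #|incident M x| <= c x) ->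
    {in N :\: M, forall e, dominates M (u e) e || dominates M (v e) e} ->
    {in M :\: N, forall e, dominates N (u e) e || dominates N (v e) e} ->
  [/\ {in N :\: M, forall e, ~~ (dominates M (u e) e && dominates M (v e) e)},
      {in M :\: N, forall e, ~~ (dominates N (u e) e && dominates N (v e) e)},
      forall x, #|dominated N M x| + #|dominated M N x| = #|incident (N :\: M) x| &
      forall x, #|dominated N M x| + #|dominated M N x| = #|incident (M :\: N) x|].
Proof.
move=> Nc Mc domM domN.
have sumI S : \sum_x #|incident S x| = 2 * #|S|.
  have trueE x : [set e in incident S x | true] = incident S x.
    by apply/setP => e; rewrite [in LHS]inE andbT.
  rewrite -(eq_bigr _ (fun x _ => congr1 (fun B : {set E} => #|B|) (trueE x))).
  by rewrite (sum_incident S (fun _ _ => true)) sum_nat_const mulnC.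
have sumD N' M' : {in N' :\: M', forall e, dominates M' (u e) e || dominates M' (v e) e} ->
    \sum_x #|dominated N' M' x| =
      \sum_(e in N' :\: M') (dominates M' (u e) e + dominates M' (v e) e) /\
    #|N' :\: M'| <= \sum_x #|dominated N' M' x|.
  move=> dom; rewrite (sum_incident _ (dominates M')); split=> //.
  rewrite -sum1_card; apply: leq_sum => e /dom.
  by case: (dominates M' (u e) e) => //= ->.
have [eqNM leNM] := sumD _ _ domM; have [eqMN leMN] := sumD _ _ domN.
have leN x := dominated_le (Nc x) (Mc x).
have leM x : #|dominated N M x| + #|dominated M N x| <= #|incident (M :\: N) x|.
  by rewrite addnC dominated_le.
have := leq_sum (index_enum V) (fun x (_ : true) => leN x).
have := leq_sum (index_enum V) (fun x (_ : true) => leM x).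
rewrite !big_split !sumI /= => sumM sumN.
(* An edge dominated at one end at least is dominated at one end only, since the total leaves no
   surplus. *)
have exact N' M' : \sum_x #|dominated N' M' x| =
      \sum_(e in N' :\: M') (dominates M' (u e) e + dominates M' (v e) e) ->
    {in N' :\: M', forall e, dominates M' (u e) e || dominates M' (v e) e} ->
    \sum_x #|dominated N' M' x| <= #|N' :\: M'| ->
    {in N' :\: M', forall e, ~~ (dominates M' (u e) e && dominates M' (v e) e)}.
  move=> -> dom le e eN.
  have one : forall e, e \in N' :\: M' -> 1 = dominates M' (u e) e + dominates M' (v e) e.
    apply: sum_leq_eq => [f /dom|]; last by rewrite sum1_card.
    by case: (dominates M' (u f) f) => //= ->.
  by have := one e eN; case: (dominates M' (u e) e); case: (dominates M' (v e) e).
split.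
- by apply: exact => //; lia.
- by apply: exact => //; lia.
- move=> x; apply: (@sum_leq_eq _ predT _ _ (fun x _ => leN x)) => //.
  by rewrite big_split sumI /=; lia.
- move=> x; apply: (@sum_leq_eq _ predT _ _ (fun x _ => leM x)) => //.
  by rewrite big_split sumI /=; lia.
Qed.

(** One of the two sets is empty by [dominated_excl], so the other accounts for all edges of its
    kind. *)
Lemma dominated_cases N M x :
    #|dominated N M x| + #|dominated M N x| = #|incident (N :\: M) x| ->
    #|dominated N M x| + #|dominated M N x| = #|incident (M :\: N) x| ->
  {in incident (N :\: M) x, forall e, dominates M x e} \/
  {in incident (M :\: N) x, forall e, dominates N x e}.
Proof.
move=> eqN eqM.
have all_dom N' M' : #|dominated N' M' x| = #|incident (N' :\: M') x| ->
    {in incident (N' :\: M') x, forall e, dominates M' x e}.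
  move=> eq_card e; have /eqP <- : dominated N' M' x == incident (N' :\: M') x.
    rewrite eqEcard eq_card leqnn andbT; apply/subsetP => f.
    by rewrite inE => /andP[].
  by rewrite inE => /andP[].
have [NM0|MN0] := dominated_excl N M x; [right | left]; apply: all_dom.
  by rewrite -eqM NM0 cards0.
by rewrite -eqN MN0 cards0 addn0.
Qed.

End Comparison.

(** * Successors and predecessors on a cycle *)

Section CyclicPerm.

Variable A : finType.
Implicit Types (p : cyclic_perm A) (i j : A).

Definition pred_in p i := (cperm p)^-1%g i.

Lemma cperm_pred_in p i : cperm p (pred_in p i) = i.
Proof. exact: permKV. Qed.

Lemma pred_in_cperm p i : pred_in p (cperm p i) = i.
Proof. exact: permK. Qed.

Lemma cset_cperm p i : (cperm p i \in cset p) = (i \in cset p).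
Proof. by have /and3P[_ onp _] := valP p; rewrite (perm_closed _ onp). Qed.

Lemma cset_pred_in p i : (pred_in p i \in cset p) = (i \in cset p).
Proof. by rewrite -cset_cperm cperm_pred_in. Qed.

Lemma cset_porbit p i : i \in cset p -> cset p = porbit (cperm p) i.
Proof. by have /and3P[_ _ /forall_inP orb] := valP p => /orb/eqP. Qed.

Lemma out_cset p i : i \notin cset p -> cperm p i = i.
Proof. by have /and3P[_ onp _] := valP p; apply: out_perm. Qed.

Lemma moved_cset p i : cperm p i != i -> i \in cset p.
Proof. by apply: contraR => /out_cset ->. Qed.

Lemma moved_card p i : cperm p i != i -> 1 < #|cset p|.
Proof.
move=> pi; have ip := moved_cset pi.
have <- : #|[set i; cperm p i]| = 2 by rewrite cards2 eq_sym pi.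
apply/subset_leq_card/subsetP => x; rewrite !inE => /orP[] /eqP-> //.
by rewrite cset_cperm.
Qed.

Lemma cset_fixpoint p i : i \in cset p -> cperm p i = i -> #|cset p| = 1.
Proof.
move=> ip pi; apply/eqP/cards1P; exists i; rewrite (cset_porbit ip).
apply/setP => x; rewrite inE; apply/porbitP/eqP => [[n ->]|->].
  by elim: n => [|n IHn]; rewrite ?expg0 ?perm1 // expgSr permM IHn.
by exists 0; rewrite expg0 perm1.
Qed.

Lemma cperm_swap p i : i \in cset p -> cperm p (cperm p i) = i ->
  val p = transposition i (cperm p i).
Proof.
move=> ip pji; set j := cperm p i.
have csetE : cset p = [set i; j].
  rewrite (cset_porbit ip); apply/setP => x; rewrite !inE.
  apply/porbitP/orP => [[n ->]|[] /eqP->].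
  - elim: n => [|n IHn]; first by rewrite expg0 perm1; left.
    by rewrite expgSr permM; case: IHn => /eqP->; rewrite ?pji eqxx; [right | left].
  - by exists 0; rewrite expg0 perm1.
  - by exists 1; rewrite expg1.
rewrite /transposition -csetE [val p]surjective_pairing; congr pair.
apply/permP => x; case: tpermP => [->|->|xi xj] //.
by apply: out_cset; rewrite csetE !inE negb_or; apply/andP; split; apply/eqP.
Qed.

Lemma odd_not_swap p i : odd #|cset p| -> 1 < #|cset p| -> i \in cset p ->
  cperm p (cperm p i) != i.
Proof.
move=> oddp p1 ip; apply: contraTneq oddp => pji.
have [pi|pi] := eqVneq (cperm p i) i; first by rewrite (cset_fixpoint ip pi) in p1.
by rewrite /cset (cperm_swap ip pji) cards2 eq_sym pi.
Qed.

End CyclicPerm.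

(** * Predecessors and arcs of a GSP *)

Section Gsp.

Variables (A : finType) (I : sf_instance A) (Pi : seq (cyclic_perm A)).
Hypothesis gspPi : is_gsp I Pi.
Implicit Types (p q : cyclic_perm A) (i j : A).

Lemma gsp_succ_pred p i : p \in Pi -> i \in cset p ->
  rank I i (cperm p i) <= rank I i (pred_in p i).
Proof. by move=> pPi ip; have := gsp_F1 gspPi pPi ip; rewrite prefeq_rank. Qed.

Definition gsp_accepts i j :=
  exists p, [/\ p \in Pi, i \in cset p & rank I i j < rank I i (pred_in p i)].

Lemma gsp_not_blocking i j : i != j -> transposition i j \notin [seq val p | p <- Pi] ->
  gsp_accepts i j -> gsp_accepts j i -> False.
Proof.
move=> nij ntr [p [pPi ip ijp]] [q [qPi jq jiq]]; case: (gsp_F2 gspPi).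
by exists i, j; split=> //; exists p, q; split=> //; rewrite pref_rank.
Qed.

Lemma count_ge2 (T : eqType) (a : pred T) (s : seq T) x y :
  x \in s -> y \in s -> x != y -> a x -> a y -> 1 < count a s.
Proof.
move=> xs ys nxy ax ay; rewrite -size_filter.
have : x \in filter a s by rewrite mem_filter ax.
have : y \in filter a s by rewrite mem_filter ay.
case: (filter a s) => [|z [|z' s']] //; rewrite !inE => /eqP eyz /eqP exz.
by rewrite exz eyz eqxx in nxy.
Qed.

(** The transposition and [p] would both send [pred_in p i] to [i], and the transposition also sends
    [i] back: three passages, against F4. *)
Lemma gsp_no_transposition p i : p \in Pi -> i \in cset p -> cperm p (cperm p i) != i ->
  transposition i (pred_in p i) \notin [seq val q | q <- Pi].
Proof.
move=> pPi ip nsw; apply/mapP => -[t tPi /esym val_t].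
set l := pred_in p i in val_t.
have nli : i != l.
  apply: contraNneq nsw => /(congr1 (cperm p)); rewrite cperm_pred_in => pi.
  by rewrite !pi.
have tE : cperm t = tperm i l by rewrite /cperm val_t.
have ntp : t != p.
  by apply: contraNneq nsw => tp; rewrite -tp tE tpermL tpermR.
have := gsp_F4 gspPi nli; rewrite leqNgt => /negP[].
have : 0 < count (fun q => cperm q i == l) Pi.
  by rewrite -has_count; apply/hasP; exists t; rewrite // tE tpermL.
have : 1 < count (fun q => cperm q l == i) Pi.
  by apply: count_ge2 tPi pPi ntp _ _; rewrite ?tE ?tpermR // cperm_pred_in.
by lia.
Qed.

(* The predecessor l of i finds i better than its own predecessor, so (i, l) would
   violate F2 if i had a worse predecessor elsewhere. *)
Lemma gsp_pred_last p q i : p \in Pi -> i \in cset p -> cperm p (cperm p i) != i ->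
  q \in Pi -> i \in cset q -> rank I i (pred_in q i) <= rank I i (pred_in p i).
Proof.
move=> pPi ip nsw qPi iq; rewrite leqNgt; apply/negP => lt.
have nip : pred_in p i != cperm p i.
  by rewrite -(inj_eq (@perm_inj _ (cperm p))) cperm_pred_in eq_sym.
have nil : i != pred_in p i.
  apply: contraNneq nsw => /(congr1 (cperm p)); rewrite cperm_pred_in => pi.
  by rewrite !pi.
apply: (gsp_not_blocking nil (gsp_no_transposition pPi ip nsw)); first by exists q.
exists p; rewrite cset_pred_in; split=> //.
have := gsp_succ_pred pPi (_ : pred_in p i \in cset p); rewrite cset_pred_in cperm_pred_in.
move=> /(_ ip); rewrite leq_eqVlt (inj_eq (@rank_inj _ _ _)) => /orP[/eqP eqi|//].
by move: nip; rewrite [in cperm p i]eqi cperm_pred_in eqxx.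
Qed.

(* Predecessors on long cycles are determined by [gsp_pred_last]: follow them
   backwards. *)
Lemma gsp_long_unique p q i : p \in Pi -> q \in Pi -> i \in cset p -> i \in cset q ->
  cperm p (cperm p i) != i -> cperm q (cperm q i) != i -> p = q.
Proof.
move=> pPi qPi ip iq np nq.
have nsw_pred (r : cyclic_perm A) x : x \in cset r -> cperm r (cperm r x) != x ->
    pred_in r x \in cset r /\ cperm r (cperm r (pred_in r x)) != pred_in r x.
  rewrite cset_pred_in => -> nr; split=> //; apply: contraNneq nr.
  by move=> /(congr1 (cperm r)); rewrite !cperm_pred_in => ->.
have pow n : let x := ((cperm p)^-1 ^+ n)%g i in
  [/\ x = ((cperm q)^-1 ^+ n)%g i, x \in cset p, x \in cset q,
      cperm p (cperm p x) != x & cperm q (cperm q x) != x].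
  elim: n => [|n] /=; first by rewrite !expg0 !perm1.
  rewrite !expgSr !permM; set x := ((cperm p)^-1 ^+ n)%g i => -[<- xp xq npx nqx].
  rewrite -/(pred_in p x) -/(pred_in q x).
  have eq_pred : pred_in p x = pred_in q x.
    by apply: (@rank_inj _ I x); apply/eqP; rewrite eqn_leq !gsp_pred_last.
  have [? ?] := nsw_pred p x xp npx; have [? ?] := nsw_pred q x xq nqx.
  by split=> //; rewrite eq_pred.
have csetE : cset p = cset q.
  rewrite (cset_porbit ip) (cset_porbit iq) -!(porbitV (cperm _)).
  by apply/setP => x; apply/porbitP/porbitP => -[n ->]; exists n; case: (pow n) => ->.
apply: val_inj; rewrite [LHS]surjective_pairing [RHS]surjective_pairing; congr pair => //.
apply: invg_inj; apply/permP => x; have [xp|xp] := boolP (x \in cset p).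
  move: xp; rewrite (cset_porbit ip) -(porbitV (cperm _)) => /porbitP[n ->].
  have [eqn _ _ _ _] := pow n; have [eqSn _ _ _ _] := pow n.+1.
  by move: eqSn; rewrite /= !expgSr !permM -eqn.
have fixV (r : cyclic_perm A) : x \notin cset r -> ((val r).2^-1)%g x = x.
  by move=> xr; apply: (@perm_inj _ (cperm r)); rewrite permKV out_cset.
by rewrite !fixV // -csetE.
Qed.

Lemma gsp_pred_inj p q i : p \in Pi -> q \in Pi -> i \in cset p -> i \in cset q ->
  cperm p i != i -> cperm q i != i -> pred_in p i = pred_in q i -> p = q.
Proof.
move=> pPi qPi ip iq npi nqi eq_pred.
have swap_pred r : r \in Pi -> i \in cset r -> cperm r (cperm r i) == i ->
    val r = transposition i (pred_in r i).
  move=> rPi ir /eqP sw; rewrite (cperm_swap ir sw); congr transposition.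
  by rewrite -{2}sw pred_in_cperm.
have [swp|nswp] := boolP (cperm p (cperm p i) == i);
  have [swq|nswq] := boolP (cperm q (cperm q i) == i).
- by apply: val_inj; rewrite !swap_pred // eq_pred.
- have := gsp_no_transposition qPi iq nswq.
  by rewrite -eq_pred -(swap_pred p) // map_f.
- have := gsp_no_transposition pPi ip nswp.
  by rewrite eq_pred -(swap_pred q) // map_f.
- exact: gsp_long_unique nswp nswq.
Qed.

Definition gsp_arc i j := (i != j) && has (fun p => cperm p i == j) Pi.

Lemma gsp_arcP i j :
  reflect (exists p, [/\ p \in Pi, i \in cset p, cperm p i != i & cperm p i = j]) (gsp_arc i j).
Proof.
apply: (iffP andP) => [[nij /hasP[p pPi /eqP pij]]|[p [pPi ip ni <-]]].
  by exists p; split=> //; [apply: moved_cset|]; rewrite pij eq_sym.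
by rewrite eq_sym; split=> //; apply/hasP; exists p.
Qed.

Definition gsp_ins i := [set j | gsp_arc j i].
Definition gsp_outs i := [set j | gsp_arc i j].

Definition moving i := [seq p <- Pi | (i \in cset p) && (cperm p i != i)].

Lemma uniq_moving i : uniq (moving i).
Proof.
rewrite (_ : moving i =
  [seq p <- [seq p <- Pi | 1 < #|cset p|] | (i \in cset p) && (cperm p i != i)]).
  exact/filter_uniq/(gsp_distinct gspPi).
rewrite -filter_predI; apply: eq_filter => p /=.
by case: (boolP (_ && _)) => // /andP[_ /moved_card ->].
Qed.

Lemma movingP p i : reflect [/\ p \in Pi, i \in cset p & cperm p i != i] (p \in moving i).
Proof. by rewrite mem_filter andbC; apply: (iffP and3P). Qed.

(** Distinct cycles moving [i] have distinct predecessors, so passing from the collection to the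
    relation [gsp_arc] loses no multiplicity. *)
Lemma card_gsp_ins i : #|gsp_ins i| = size (moving i).
Proof.
rewrite -(size_map (fun p => pred_in p i)); have /card_uniqP <- :
    uniq [seq pred_in p i | p <- moving i].
  rewrite map_inj_in_uniq ?uniq_moving // => p q /movingP[? ? ?] /movingP[? ? ?].
  exact: gsp_pred_inj.
apply: eq_card => j; rewrite inE; apply/gsp_arcP/mapP => [[p [pPi jp nj <-]]|].
  exists p; rewrite ?pred_in_cperm //; apply/movingP; rewrite cset_cperm; split=> //.
  by rewrite (inj_eq perm_inj).
case=> p /movingP[pPi ip ni] ->; exists p; rewrite cset_pred_in cperm_pred_in; split=> //.
by rewrite -(inj_eq (@perm_inj _ (cperm p))) cperm_pred_in.
Qed.

Lemma card_gsp_outs i : #|gsp_outs i| = size (moving i).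
Proof.
rewrite -(size_map (fun p => cperm p i)); have /card_uniqP <- :
    uniq [seq cperm p i | p <- moving i].
  rewrite map_inj_in_uniq ?uniq_moving // => p q /movingP[pPi ip np] /movingP[qPi iq nq] eqi.
  apply: (@gsp_pred_inj p q (cperm p i)) => //; rewrite ?cset_cperm //.
  - by rewrite eqi cset_cperm.
  - by rewrite (inj_eq perm_inj).
  - by rewrite eqi (inj_eq perm_inj).
  - by rewrite {2}eqi !pred_in_cperm.
apply: eq_card => j; rewrite inE; apply/gsp_arcP/mapP => [[p [pPi ip ni <-]]|].
  by exists p => //; apply/movingP.
by case=> p /movingP[pPi ip ni] ->; exists p.
Qed.

Lemma size_moving_le i : size (moving i) <= cap I i.
Proof.
rewrite size_filter -(gsp_F3 gspPi i); apply: sub_count => p /=.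
by case/andP.
Qed.

(** At a fixed point the predecessor of [i] is [i] itself, ranked last, so [i] would accept [j].
    Hence every cycle through [i] moves it. *)
Lemma size_moving i j : i != j -> ~ gsp_accepts i j -> size (moving i) = cap I i.
Proof.
move=> nij nacc; rewrite size_filter -(gsp_F3 gspPi i); apply: eq_in_count => p pPi /=.
have [ip|//] := boolP (i \in cset p); apply/eqP => pi; apply: nacc; exists p; split=> //.
have -> : pred_in p i = i by rewrite -{1}pi pred_in_cperm.
by rewrite -pref_rank; apply: pref_self_last; rewrite eq_sym.
Qed.

Lemma gsp_rejects p i j : ~ gsp_accepts i j -> p \in Pi -> i \in cset p ->
  rank I i (pred_in p i) <= rank I i j.
Proof. by move=> nacc pPi ip; rewrite leqNgt; apply/negP => lt; apply: nacc; exists p. Qed.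

End Gsp.

(** * A stable matching against a GSP in the double cover *)

Section StableVersusGsp.

Variables (A : finType) (I : sf_instance A) (Pi : seq (cyclic_perm A)) (M : {set {set A}}).
Hypotheses (gspPi : is_gsp I Pi) (stM : stable_matching I M).
Implicit Types (p q : cyclic_perm A) (i j : A) (e : A * A) (S : {set A * A}).

Let M2 (b : {set A}) : b \in M -> #|b| = 2.
Proof. by case: stM => -[M2 _] _; apply: M2. Qed.

Definition proposer e : bool * A := (true, e.1).
Definition receiver e : bool * A := (false, e.2).
Definition side_cap (x : bool * A) := cap I x.2.
Definition side_rank (x : bool * A) e := rank I x.2 (if x.1 then e.2 else e.1).

Definition gsp_arcs := [set e | gsp_arc Pi e.1 e.2].
Definition matching_arcs := [set e : A * A | [set e.1; e.2] \in M].

Notation incident := (incident proposer receiver).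
Notation dominates := (dominates proposer receiver side_cap side_rank).

Lemma incident_proposer S i :
  incident S (true, i) = [set (i, j) | j in [set j | (i, j) \in S]].
Proof.
apply/setP => -[a b]; rewrite !inE /proposer /receiver /= !xpair_eqE /= orbF.
apply/andP/imsetP => [[abS /eqP <-]|[j + [-> ->]]]; first by exists b; rewrite ?inE.
by rewrite inE.
Qed.

Lemma incident_receiver S i :
  incident S (false, i) = [set (j, i) | j in [set j | (j, i) \in S]].
Proof.
apply/setP => -[a b]; rewrite !inE /proposer /receiver /= !xpair_eqE /=.
apply/andP/imsetP => [[abS /eqP <-]|[j + [-> ->]]]; first by exists a; rewrite ?inE.
by rewrite inE.
Qed.

Lemma card_incident_proposer S i : #|incident S (true, i)| = #|[set j | (i, j) \in S]|.
Proof. by rewrite incident_proposer card_imset // => j k []. Qed.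

Lemma card_incident_receiver S i : #|incident S (false, i)| = #|[set j | (j, i) \in S]|.
Proof. by rewrite incident_receiver card_imset // => j k []. Qed.

Lemma dominates_proposer S i j : dominates S (true, i) (i, j) =
  (cap I i <= #|[set k | (i, k) \in S]|) &&
  [forall k in [set k | (i, k) \in S], rank I i k < rank I i j].
Proof.
rewrite /dominates card_incident_proposer incident_proposer; congr andb.
apply/forall_inP/forall_inP => [ltj k kS|ltj _ /imsetP[k kS ->]]; last exact: ltj.
by apply: (ltj (i, k)); rewrite imset_f.
Qed.

Lemma dominates_receiver S i j : dominates S (false, i) (j, i) =
  (cap I i <= #|[set k | (k, i) \in S]|) &&
  [forall k in [set k | (k, i) \in S], rank I i k < rank I i j].
Proof.
rewrite /dominates card_incident_receiver incident_receiver; congr andb.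
apply/forall_inP/forall_inP => [ltj k kS|ltj _ /imsetP[k kS ->]]; last exact: ltj.
by apply: (ltj (k, i)); rewrite imset_f.
Qed.

Lemma matching_arcs_out i : [set k | (i, k) \in matching_arcs] = partners M i.
Proof. by apply/setP => k; rewrite !inE. Qed.

Lemma matching_arcs_in i : [set k | (k, i) \in matching_arcs] = partners M i.
Proof. by apply/setP => k; rewrite !inE setUC. Qed.

Lemma gsp_arcs_out i : [set k | (i, k) \in gsp_arcs] = gsp_outs Pi i.
Proof. by apply/setP => k; rewrite !inE. Qed.

Lemma gsp_arcs_in i : [set k | (k, i) \in gsp_arcs] = gsp_ins Pi i.
Proof. by apply/setP => k; rewrite !inE. Qed.

(** Since [matching_arcs] is symmetric, this expresses domination by the matching at either copy of
    [i]. *)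
Definition prefers_partners i j :=
  (cap I i <= #|partners M i|) && [forall k in partners M i, rank I i k < rank I i j].

Lemma matching_dominates_proposer i j :
  dominates matching_arcs (true, i) (i, j) = prefers_partners i j.
Proof. by rewrite dominates_proposer matching_arcs_out. Qed.

Lemma matching_dominates_receiver i j :
  dominates matching_arcs (false, i) (j, i) = prefers_partners i j.
Proof. by rewrite dominates_receiver matching_arcs_in. Qed.

Lemma card_partners_le i : #|partners M i| <= cap I i.
Proof. by rewrite -card_partners //; case: stM => -[_ capM] _; apply: capM. Qed.

Lemma gsp_arcs_cap x : #|incident gsp_arcs x| <= side_cap x.
Proof.
case: x => -[] i; rewrite /side_cap /=.
  by rewrite card_incident_proposer gsp_arcs_out (card_gsp_outs gspPi) size_moving_le.
by rewrite card_incident_receiver gsp_arcs_in (card_gsp_ins gspPi) size_moving_le.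
Qed.

Lemma matching_arcs_cap x : #|incident matching_arcs x| <= side_cap x.
Proof.
case: x => -[] i; rewrite /side_cap /=.
  by rewrite card_incident_proposer matching_arcs_out card_partners_le.
by rewrite card_incident_receiver matching_arcs_in card_partners_le.
Qed.

Lemma not_accepts i j : j \notin partners M i -> ~~ accepts I M i j -> prefers_partners i j.
Proof.
move=> jM; rewrite /accepts negb_or -leqNgt /prefers_partners => /andP[-> /=].
rewrite pref_rank -leqNgt => le_w; apply/forall_inP => k kM.
have [|_ wmax] := worstP I i (_ : partners M i != set0).
  by apply/set0Pn; exists k.
rewrite ltn_neqAle (inj_eq (@rank_inj _ _ _)) (leq_trans (wmax _ kM)) // andbT.
by apply: contraNneq jM => <-.
Qed.

Lemma matching_dominates :
  {in gsp_arcs :\: matching_arcs, forall e,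
     dominates matching_arcs (proposer e) e || dominates matching_arcs (receiver e) e}.
Proof.
case=> i j; rewrite inE [(i, j) \in gsp_arcs]inE /= => /andP[ijM /andP[nij _]].
rewrite inE /= in ijM.
rewrite matching_dominates_proposer matching_dominates_receiver.
have := stM.2 i j; rewrite /blocking_pair nij ijM /= negb_and orbC.
by case/orP=> /not_accepts ->; rewrite ?orbT // inE // setUC.
Qed.

Lemma gsp_arcs_transposition i j : i != j ->
  transposition i j \in [seq val p | p <- Pi] -> gsp_arc Pi i j.
Proof.
move=> nij /mapP[p pPi def_p]; rewrite /gsp_arc nij; apply/hasP; exists p => //.
by rewrite /cperm -def_p tpermL.
Qed.

Lemma gsp_arc_not_blocking i j : i != j -> ~~ gsp_arc Pi i j ->
  gsp_accepts I Pi i j -> gsp_accepts I Pi j i -> False.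
Proof.
by move=> nij /(contra (gsp_arcs_transposition nij)); apply: gsp_not_blocking.
Qed.

Lemma gsp_accepts_dec i j : gsp_accepts I Pi i j \/ ~ gsp_accepts I Pi i j.
Proof.
have [/hasP[p pPi /andP[ip lt]]|/hasPn nacc] :=
    boolP (has (fun p => (i \in cset p) && (rank I i j < rank I i (pred_in p i))) Pi).
  by left; exists p.
by right=> -[p [/nacc/negP np ip lt]]; apply: np; rewrite ip.
Qed.

Lemma gsp_dominates_receiver i j : i != j -> ~~ gsp_arc Pi i j ->
  ~ gsp_accepts I Pi j i -> dominates gsp_arcs (false, j) (i, j).
Proof.
move=> nij ijN nacc; have nji : j != i by rewrite eq_sym.
rewrite dominates_receiver gsp_arcs_in (card_gsp_ins gspPi) (size_moving gspPi nji nacc) leqnn.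
apply/forall_inP => k; rewrite inE => kj; rewrite ltn_neqAle (inj_eq (@rank_inj _ _ _)).
rewrite (contraNneq _ ijN) => [|<- //]; case/gsp_arcP: kj => p [pPi kp _ pk].
by have := gsp_rejects nacc pPi; rewrite -pk cset_cperm pred_in_cperm; apply.
Qed.

(** Refusal concerns predecessors; F1 extends it to successors, which rank at least as high. *)
Lemma gsp_dominates_proposer i j : i != j -> ~~ gsp_arc Pi i j ->
  ~ gsp_accepts I Pi i j -> dominates gsp_arcs (true, i) (i, j).
Proof.
move=> nij ijN nacc.
rewrite dominates_proposer gsp_arcs_out (card_gsp_outs gspPi) (size_moving gspPi nij nacc) leqnn.
apply/forall_inP => k; rewrite inE => ik; rewrite ltn_neqAle (inj_eq (@rank_inj _ _ _)).
rewrite (contraNneq _ ijN) => [|<- //]; case/gsp_arcP: ik => p [pPi ip _ <-].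
exact/(leq_trans (gsp_succ_pred gspPi pPi ip))/(gsp_rejects nacc).
Qed.

Lemma gsp_dominates :
  {in matching_arcs :\: gsp_arcs, forall e,
     dominates gsp_arcs (proposer e) e || dominates gsp_arcs (receiver e) e}.
Proof.
case=> i j; rewrite inE [(i, j) \in matching_arcs]inE /= => /andP[ijN ijM].
rewrite inE /= in ijN; have nij : i != j by have := M2 ijM; rewrite cards2; case: eqP.
have [aij|nacc] := gsp_accepts_dec i j; last first.
  by rewrite [proposer _]/= gsp_dominates_proposer.
have [aji|nacc] := gsp_accepts_dec j i; last first.
  by rewrite orbC [receiver _]/= gsp_dominates_receiver.
by case: (gsp_arc_not_blocking nij ijN aij aji).
Qed.

(** A cycle [q] from [j] to [i] would be a transposition, excluded by [gsp_no_transposition], or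
    equal to [p] by [gsp_long_unique]; but [p] does not swap [i] and [j]. *)
Lemma gsp_long_one_way p i j : p \in Pi -> i \in cset p ->
  cperm p (cperm p i) != i -> cperm p i = j -> ~~ gsp_arc Pi j i.
Proof.
move=> pPi ip nsw pij; apply/gsp_arcP => -[q [qPi jq nj qji]].
have npi : cperm p i != i by apply: contraNneq nsw => pi; rewrite !pi.
have nswj : cperm p (cperm p j) != j.
  by rewrite -pij (inj_eq perm_inj).
have jp : j \in cset p by rewrite -pij cset_cperm.
have [/eqP swq|nswq] := boolP (cperm q (cperm q j) == j).
  have := gsp_no_transposition gspPi pPi jp nswj.
  by rewrite -pij pred_in_cperm pij -qji -(cperm_swap jq swq) map_f.
move: nsw; rewrite pij; rewrite (gsp_long_unique gspPi pPi qPi jp jq nswj nswq) qji.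
by rewrite eqxx.
Qed.

Lemma prefers_partners_alternate p i : p \in Pi -> i \in cset p ->
    (forall k, k \in cset p -> cperm p (cperm p k) != k) ->
  prefers_partners (cperm p i) i = ~~ prefers_partners i (pred_in p i).
Proof.
move=> pPi ip nswp; set j := cperm p i; set w := pred_in p i.
have nsw := nswp i ip.
have npi : j != i by apply: contraNneq nsw => pi; rewrite -/j pi -/j pi.
have nwj : w != j by rewrite -(inj_eq (@perm_inj _ (cperm p))) cperm_pred_in eq_sym.
have ijN : (i, j) \in gsp_arcs by rewrite inE; apply/gsp_arcP; exists p.
have wiN : gsp_arc Pi w i.
  apply/gsp_arcP; exists p; rewrite cset_pred_in cperm_pred_in; split=> //.
  by rewrite -(inj_eq (@perm_inj _ (cperm p))) cperm_pred_in.
have ltjw : rank I i j < rank I i w.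
  by rewrite ltn_neqAle (inj_eq (@rank_inj _ _ _)) eq_sym nwj (gsp_succ_pred gspPi pPi ip).
have [oneM oneN eqN eqM] :=
  dominated_eq (fun e => isT : proposer e != receiver e) gsp_arcs_cap matching_arcs_cap
    matching_dominates gsp_dominates.
have cases x := dominated_cases (eqN x) (eqM x).
have [ijM|ijM] := boolP ((i, j) \in matching_arcs).
  have -> : prefers_partners j i = false.
    apply/negP => /andP[_ /forall_inP/(_ i)]; rewrite ltnn => contra.
    by move: ijM; rewrite inE setUC => ijM; have := contra _; rewrite inE => /(_ ijM).
  (* The reverse pair [(j, i)] is in the matching only, and the arcs do not dominate it at the
     receiver [i], because [w] is worse than [j]. So there the matching dominates all arcs outside
     it. *)
  apply/esym/negbF.
  have jiMN : (j, i) \in incident (matching_arcs :\: gsp_arcs) (false, i).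
    rewrite incident_receiver imset_f // !inE (gsp_long_one_way pPi ip nsw) //=.
    by rewrite inE setUC in ijM.
  have [domM|domN] := cases (false, i); last first.
    have := domN _ jiMN; rewrite dominates_receiver => /andP[_ /forall_inP/(_ w)].
    by rewrite !inE wiN => /(_ isT); rewrite ltnNge ltnW.
  have [wM|wM] := boolP (w \in partners M i); last first.
    rewrite -matching_dominates_receiver; apply: domM.
    by rewrite incident_receiver imset_f // !inE /= wiN setUC andbT; rewrite inE in wM.
  (* If [w] is a partner, equal cardinalities give an arc [(t, i)] outside the matching. Its
     domination would make [w] better than [t], but [w] is the worst predecessor. *)
  have : 0 < #|incident (gsp_arcs :\: matching_arcs) (false, i)|.
    by rewrite -eqN eqM; apply/card_gt0P; exists (j, i).
  case/card_gt0P=> e eN; have := domM e eN.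
  move: eN; rewrite incident_receiver => /imsetP[t].
  rewrite 2!inE => /andP[_ tiN] ->; rewrite matching_dominates_receiver.
  move=> /andP[_ /forall_inP/(_ w wM)]; rewrite inE /= in tiN.
  case/gsp_arcP: tiN => q [qPi tq _ qt].
  have iq : i \in cset q by rewrite -qt cset_cperm.
  have := gsp_pred_last gspPi pPi ip nsw qPi iq.
  have -> : pred_in q i = t by rewrite -qt pred_in_cperm.
  by rewrite -/w leqNgt => /negbTE ->.
(* Now [(i, j)] is dominated at exactly one end, so it remains to replace [j] by [w] in the
   condition at [i]. *)
have ijNM : (i, j) \in gsp_arcs :\: matching_arcs by rewrite inE ijM.
have := oneM _ ijNM; have := matching_dominates ijNM.
rewrite matching_dominates_proposer matching_dominates_receiver /=.
have -> : prefers_partners i j = prefers_partners i w; last first.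
  by case: prefers_partners; case: prefers_partners.
apply/idP/idP => [/andP[capi /forall_inP ltj]|highi].
  rewrite /prefers_partners capi; apply/forall_inP => k /ltj.
  by move/ltn_trans; apply.
have ijI : (i, j) \in incident (gsp_arcs :\: matching_arcs) (true, i).
  by rewrite incident_proposer imset_f // inE.
have [domM|domN] := cases (true, i).
  by rewrite -matching_dominates_proposer; apply: domM.
(* Otherwise some matched [(i, y)] that is no arc is dominated at the proposer [i]. As [i] prefers
   [y] to [w], F2 makes [y] refuse [i], and the pair is dominated at both ends. *)
have : 0 < #|incident (matching_arcs :\: gsp_arcs) (true, i)|.
  by rewrite -eqM eqN; apply/card_gt0P; exists (i, j).
case/card_gt0P=> e eM; have := domN e eM.
move: eM; rewrite incident_proposer => /imsetP[y]; rewrite inE => iyMN -> dom_i.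
have iyMN' := iyMN; rewrite 3!inE /= in iyMN'; case/andP: iyMN' => iyN iyM.
have niy : i != y by have := M2 iyM; rewrite cards2; case: eqP.
have aiy : gsp_accepts I Pi i y.
  exists p; split=> //; case/andP: highi => _ /forall_inP; apply.
  by rewrite inE.
have nacc : ~ gsp_accepts I Pi y i by apply: gsp_arc_not_blocking aiy.
have := oneN _ iyMN; rewrite dom_i /=.
by rewrite gsp_dominates_receiver.
Qed.

Lemma gsp_no_odd_cycle p : p \in Pi -> odd #|cset p| -> 1 < #|cset p| -> False.
Proof.
move=> pPi oddp p1; have nsw := odd_not_swap oddp p1.
(* By alternation [cperm p] maps [S] onto its complement in the cycle, so the length is twice the
   size of [S]. *)
pose S := [set i in cset p | prefers_partners i (pred_in p i)].
have SD : cperm p @: S = cset p :\: S.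
  apply/setP => j; rewrite !inE; apply/imsetP/andP => [[i + ->]|[jS jp]].
    rewrite inE => /andP[ip hi]; rewrite cset_cperm ip pred_in_cperm.
    by rewrite (prefers_partners_alternate pPi ip) // hi.
  exists (pred_in p j); rewrite ?cperm_pred_in // inE cset_pred_in jp /=.
  have pjp : pred_in p j \in cset p by rewrite cset_pred_in.
  have := prefers_partners_alternate pPi pjp nsw; rewrite cperm_pred_in => alt.
  by apply: contraR jS => lo; rewrite jp alt.
have : #|cset p| = #|S| + #|S|.
  rewrite -(cardsID S (cset p)) -SD card_imset; last exact: perm_inj.
  by rewrite (setIidPr _) //; apply/subsetP => i; rewrite inE => /andP[].
by move=> eqp; rewrite eqp addnn odd_double in oddp.
Qed.

End StableVersusGsp.

Theorem theorem12 (A : finType) (I : sf_instance A) :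
  (exists M : {set {set A}}, stable_matching I M) <->
  ~ (exists Pi : seq (cyclic_perm A), is_gsp I Pi /\
       (exists p : cyclic_perm A,
          [/\ p \in Pi, odd #|cset p| & 1 < #|cset p|])).
Proof.
split=> [[M stM] [Pi [gspPi [p [pPi oddp p1]]]]|no_odd].
  exact: gsp_no_odd_cycle gspPi stM p pPi oddp p1.
have [L [LU defL Lmax]] := maximal_acceptable I.
have [H0|/set0Pn[i iH]] := eqVneq (halved L (acceptable I L)) set0.
  exact: stable_of_unhalved LU erefl (esym defL) H0.
case: no_odd; eexists; split; first exact: (maximal_gspP LU erefl (esym defL) Lmax).
exact: maximal_gsp_odd iH.
Qed.
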